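(* If $\gamma$ and $\delta$ are geodesics of $\Sigma$, then the map $f(t)=dist(\gamma(t),\delta(t))$ is a convex function of $t$.
   Context: ${\cal A}$ is a von Neumann algebra with a finite, normal, faithful tracial state $\tau$; ${\cal A}_h$ is the real space of selfadjoint elements of ${\cal A}$; $\Sigma=e^{{\cal A}_h}$ is the set of positive invertible elements of ${\cal A}$, an open subset of ${\cal A}_h$ in the operator norm topology. For $a\in\Sigma$ and $x,y\in{\cal A}_h$ put $\langle x,y\rangle_a=\tau(xa^{-1}ya^{-1})$ and $\|x\|_a=\langle x,x\rangle_a^{1/2}$. A smooth curve is a continuously differentiable curve (derivative with respect to the operator norm) $\gamma:[0,1]\to\Sigma$, with $Length(\gamma)=\int_0^1\|\dot\gamma(t)\|_{\gamma(t)}\,dt$, and $dist(a,b)$ is the infimum of the lengths of smooth curves in $\Sigma$ joining $a$ and $b$. The geodesics of $\Sigma$ are the solutions of $\ddot\gamma=\dot\gamma\gamma^{-1}\dot\gamma$, i.e. the curves $\gamma(t)=p^{1/2}e^{t\,p^{-1/2}vp^{-1/2}}p^{1/2}$ with $p\in\Sigma$, $v\in{\cal A}_h$. *)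

(* Defs.v *)
From HB Require Import structures.
From mathcomp Require Import all_boot all_order all_algebra.
From mathcomp Require Import all_classical all_reals all_analysis.
From mathcomp Require Import complex.

Set Implicit Arguments.
Unset Strict Implicit.
Unset Printing Implicit Defensive.

Import Order.TTheory GRing.Theory Num.Theory.
Import numFieldNormedType.Exports.

Local Open Scope classical_set_scope.
Local Open Scope ring_scope.
Local Open Scope complex_scope.

Section Operators.
Context (R : realType) (H : completeNormedModType R[i]).
Context (dot : {dot H for Num.conj}).
Implicit Types (S T : H -> H) (A : set (H -> H)).

(* Operators on H are plain functions: the product is composition (not the
   pointwise one), sums and scalings are pointwise. *)
Definition bounded_op : set (H -> H) := [set T | linear T /\ continuous T].

(* Meaningful on bounded operators only: the real sup of an unbounded set
   is 0, which is why membership in an algebra of bounded operators is always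
   required alongside. *)
Definition opnorm T : R :=
  sup [set complex.Re `|T x| | x in [set x : H | `|x| <= 1]].

Definition adjoint_pair T S := forall x y, dot (T x) y = dot x (S y).

(* The order of R[i] makes 0 <= z entail that z is real. *)
Definition positive_op T := forall x, 0 <= dot (T x) x.

Definition op_le S T := positive_op (T - S).

Definition commutant A : set (H -> H) :=
  [set T | bounded_op T /\ forall S, A S -> T \o S = S \o T].

(* A self-adjoint set of bounded operators equal to its bicommutant is
   automatically a unital subalgebra of B(H). *)
Definition von_neumann_algebra A :=
  [/\ A `<=` bounded_op,
      (forall T, A T -> exists2 S, A S & adjoint_pair T S) &
      commutant (commutant A) = A].

Definition selfadjoint_part A : set (H -> H) :=
  [set T | A T /\ adjoint_pair T T].

Definition op_inv T : H -> H :=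
  xget (idfun : H -> H) [set S : H -> H | T \o S = idfun /\ S \o T = idfun].

Definition positive_cone A : set (H -> H) :=
  [set a | [/\ A a, positive_op a &
    exists b, [/\ A b, a \o b = idfun & b \o a = idfun]]].

Definition op_lub A (D : set (H -> H)) T :=
  [/\ selfadjoint_part A T,
      (forall S, D S -> op_le S T) &
      forall U, selfadjoint_part A U -> (forall S, D S -> op_le S U) ->
        op_le T U].

Definition op_directed (D : set (H -> H)) :=
  D !=set0 /\
  forall S T, D S -> D T -> exists U, [/\ D U, op_le S U & op_le T U].

Section State.
Variables (A : set (H -> H)) (tau : (H -> H) -> R[i]).

Definition is_state :=
  [/\ (forall (c : R[i]) S T, A S -> A T ->
         tau (c *: S + T) = c * tau S + tau T),
      (forall T, A T -> positive_op T -> 0 <= tau T) &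
      tau idfun = 1].

Definition is_tracial := forall S T, A S -> A T -> tau (S \o T) = tau (T \o S).

Definition is_faithful :=
  forall T, A T -> positive_op T -> tau T = 0 -> T = 0.

Definition is_normal :=
  forall D T, D `<=` selfadjoint_part A -> op_directed D -> op_lub A D T ->
    isLub (tau @` D) (tau T).

Definition metric (a x y : H -> H) : R[i] :=
  tau (x \o op_inv a \o y \o op_inv a).

(* metric a x x is a nonnegative real when a is in the cone and x is
   self-adjoint *)
Definition metric_norm (a x : H -> H) : R :=
  Num.sqrt (complex.Re (metric a x x)).

(* Operator-norm derivative of g at t relative to J, hence one-sided at an
   endpoint of J. *)
Definition op_deriv (J : set R) (g : R -> H -> H) (t : R) (v : H -> H) :=
  A v /\
  opnorm (((s - t)^-1)%:C *: (g s - g t) - v) @[s --> within J t^'] --> (0 : R).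

Definition op_continuous_on (J : set R) (g : R -> H -> H) :=
  forall t, J t -> opnorm (g s - g t) @[s --> within J (nbhs t)] --> (0 : R).

(* dg is determined by g on `[0, 1], so curve_length depends on g only. *)
Definition smooth_curve (g dg : R -> H -> H) :=
  [/\ (forall t, `[0, 1]%classic t -> positive_cone A (g t)),
      (forall t, `[0, 1]%classic t -> op_deriv `[0, 1]%classic g t (dg t)) &
      op_continuous_on `[0, 1]%classic dg].

Definition curve_length (g dg : R -> H -> H) : R :=
  (\int[lebesgue_measure]_(t in `[0, 1]) metric_norm (g t) (dg t))%R.

Definition dist (a b : H -> H) : R :=
  inf [set l | exists g dg,
    [/\ smooth_curve g dg, g 0 = a, g 1 = b & l = curve_length g dg]].

(* solutions on J of g'' = g' g^-1 g' *)
Definition geodesic_on (J : set R) (g : R -> H -> H) :=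
  exists g1 g2 : R -> H -> H, forall t, J t ->
    [/\ positive_cone A (g t), op_deriv J g t (g1 t), op_deriv J g1 t (g2 t) &
        g2 t = g1 t \o op_inv (g t) \o g1 t].

End State.
End Operators.

(* Main.v *)
Require Import Defs.
From HB Require Import structures.
From mathcomp Require Import all_boot all_order all_algebra.
From mathcomp Require Import all_classical all_reals all_analysis.
From mathcomp Require Import complex.
From mathcomp Require Import ring lra.
Set Implicit Arguments.
Unset Strict Implicit.
Unset Printing Implicit Defensive.
Import Order.TTheory GRing.Theory Num.Theory.
Import numFieldNormedType.Exports.
Local Open Scope classical_set_scope.
Local Open Scope ring_scope.
Local Open Scope complex_scope.

(** The distance is an infimum of lengths, so it can be estimated by transporting
   curves, and the whole proof takes place at the level of curves.

   Midpoint convexity.  Along a geodesic, [gamma^-1 gamma'] and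
   [gamma' gamma^-1] are constant, hence [gamma m], for [m] the midpoint of [s]
   and [t], is the geometric mean of [gamma s] and [gamma t]: the positive
   solution [x] of [x (gamma s)^-1 x = gamma t] ([geodesic_midpoint]).  Take a
   nearly minimal curve [a] from [gamma s] to [delta s] and another one [b] from
   [gamma t] to [delta t].  The geometric mean of [a u] and [b u] traces a curve
   from [gamma m] to [delta m].  Nonpositive curvature enters through the
   infinitesimal inequality [geometric_mean_speed]: the speed of this curve is at
   most the average of the speeds of [a] and [b].  Behind it is the Corach-Porta-Recht
   inequality [2 |x| <= |q x q^-1 + q^-1 x q|], for self-adjoint [x] and positive
   invertible [q], in the norm of the trace; it comes down to the positivity of
   the trace of [v^* v] for a commutator [v].  Integrating gives [dist_mean].

   From midpoints to all points.  The distance is at most the length of the line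
   segment between [gamma t] and [delta t], hence bounded on compact intervals
   ([dist_bounded]), and a midpoint convex function that is bounded above on a
   segment is convex there ([midpoint_convex]).

   The mean is built as [g s g] with [g] the square root of [a] and [s] that of
   [g^-1 b g^-1], so the analytic input is that the square root of a
   continuously differentiable curve is continuously differentiable.  Its
   derivative [x], for the root [r] of a curve [a], solves the Sylvester equation
   [r x + x r = a'].  Square roots, inverses and solutions of Sylvester equations
   all come from contractions, once positivity and invertibility of [a] are
   expressed by an estimate [|c - a| <= c - m] with [0 < m]; a lower bound for
   [x |-> a x + x b] ([sylvester_lower_bound]) gives uniqueness, continuity and
   differentiability.  For this the von Neumann algebra is made into a Banach algebra [opalg]:
   completeness holds because a bicommutant is stable under limits. *)

(** * Deciding identities in a noncommutative ring *)

(** Most identities below live in an operator algebra, where the order of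
   factors matters.  They are decided by reflection: both sides are expanded
   into integer combinations of words in the atoms and compared. *)
Inductive nc_expr :=
  | NCvar of nat | NC0 | NC1
  | NCadd of nc_expr & nc_expr | NCopp of nc_expr | NCmul of nc_expr & nc_expr.

Section NoncommutativeRing.
Context (B : nzRingType).
Implicit Types (e : nc_expr) (s : seq B) (l : seq (int * seq nat)).

Fixpoint nc_eval s e : B :=
  match e with
  | NCvar n => s`_n
  | NC0 => 0
  | NC1 => 1
  | NCadd e1 e2 => nc_eval s e1 + nc_eval s e2
  | NCopp e1 => - nc_eval s e1
  | NCmul e1 e2 => nc_eval s e1 * nc_eval s e2
  end.

Definition nc_word s (w : seq nat) : B := \prod_(i <- w) s`_i.

Definition nc_sum s l : B := \sum_(t <- l) nc_word s t.2 *~ t.1.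

Fixpoint nc_insert (t : int * seq nat) l :=
  if l is u :: l' then
    if u.2 == t.2 then (t.1 + u.1, u.2) :: l' else u :: nc_insert t l'
  else [:: t].

Definition nc_merge l1 l2 := foldr nc_insert l2 l1.

Fixpoint nc_normal e : seq (int * seq nat) :=
  match e with
  | NCvar n => [:: (1, [:: n])]
  | NC0 => [::]
  | NC1 => [:: (1, [::])]
  | NCadd e1 e2 => nc_merge (nc_normal e1) (nc_normal e2)
  | NCopp e1 => [seq (- t.1, t.2) | t <- nc_normal e1]
  | NCmul e1 e2 =>
    nc_merge [seq (t.1 * u.1, t.2 ++ u.2) | t <- nc_normal e1, u <- nc_normal e2] [::]
  end.

Lemma nc_sum_insert s t l :
  nc_sum s (nc_insert t l) = nc_word s t.2 *~ t.1 + nc_sum s l.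
Proof.
elim: l => [|u l IH] /=; first by rewrite /nc_sum big_seq1 big_nil addr0.
case: eqP => [e|_]; rewrite /nc_sum !big_cons.
  by rewrite /= -e mulrzDr addrA.
by rewrite -!/(nc_sum _ _) IH addrCA.
Qed.

Lemma nc_sum_merge s l1 l2 : nc_sum s (nc_merge l1 l2) = nc_sum s l1 + nc_sum s l2.
Proof.
elim: l1 => [|t l1 IH] /=; first by rewrite /nc_sum big_nil add0r.
by rewrite nc_sum_insert IH addrA [in RHS]/nc_sum big_cons.
Qed.

Lemma nc_normalE s e : nc_eval s e = nc_sum s (nc_normal e).
Proof.
elim: e => [n|||e1 IH1 e2 IH2|e1 IH1|e1 IH1 e2 IH2] /=.
- by rewrite /nc_sum big_seq1 /nc_word big_seq1.
- by rewrite /nc_sum big_nil.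
- by rewrite /nc_sum big_seq1 /nc_word big_nil.
- by rewrite IH1 IH2 nc_sum_merge.
- by rewrite IH1 /nc_sum big_map -sumrN; apply: eq_bigr => t _; rewrite mulrNz.
- rewrite IH1 IH2 nc_sum_merge [X in _ + X]/nc_sum big_nil addr0.
  rewrite /nc_sum big_allpairs_dep mulr_suml; apply: eq_bigr => t _.
  rewrite mulr_sumr; apply: eq_bigr => u _ /=.
  by rewrite /nc_word big_cat/= mulrzAl mulrzAr -mulrzA mulrC.
Qed.

Lemma nc_ringP s e1 e2 :
  all (fun t => t.1 == 0) (nc_normal (NCadd e1 (NCopp e2))) ->
  nc_eval s e1 = nc_eval s e2.
Proof.
move=> h; apply/eqP; rewrite -subr_eq0; apply/eqP.
rewrite -[LHS]/(nc_eval s (NCadd e1 (NCopp e2))) nc_normalE.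
move: (nc_normal _) h => l; rewrite /nc_sum; elim: l => [|t l IH] /=.
  by rewrite big_nil.
by move=> /andP[/eqP t0 /IH]; rewrite big_cons t0 mulr0z add0r.
Qed.

End NoncommutativeRing.

Ltac nc_index x s :=
  match s with
  | ?y :: _ => let _ := match goal with _ => unify x y end in constr:(0%N)
  | _ :: ?s' => let n := nc_index x s' in constr:(S n)
  end.

Ltac nc_atoms s e :=
  lazymatch e with
  | GRing.zero => s
  | GRing.one _ => s
  | GRing.add ?a ?b => let s' := nc_atoms s a in nc_atoms s' b
  | GRing.opp ?a => nc_atoms s a
  | GRing.mul ?a ?b => let s' := nc_atoms s a in nc_atoms s' b
  | _ => match s with
         | _ => let n := nc_index e s in s
         | _ => constr:(e :: s)
         end
  end.

Ltac nc_reify s e :=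
  lazymatch e with
  | GRing.zero => constr:(NC0)
  | GRing.one _ => constr:(NC1)
  | GRing.add ?a ?b =>
    let a' := nc_reify s a in let b' := nc_reify s b in constr:(NCadd a' b')
  | GRing.opp ?a => let a' := nc_reify s a in constr:(NCopp a')
  | GRing.mul ?a ?b =>
    let a' := nc_reify s a in let b' := nc_reify s b in constr:(NCmul a' b')
  | _ => let n := nc_index e s in constr:(NCvar n)
  end.

Ltac nc_ring :=
  match goal with
  | |- @eq ?T ?x ?y =>
    let s := nc_atoms (@nil T) x in let s := nc_atoms s y in
    let e1 := nc_reify s x in let e2 := nc_reify s y in
    refine (@nc_ringP _ s e1 e2 _); vm_compute; reflexivity
  end.

(** * Operators on a complex normed space *)

Section RealNorm.
Context (R : realType) (H : normedModType R[i]).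
Implicit Types (x y : H) (c : R[i]) (r : R).

(** The norm of [H] takes its values in [R[i]]; all estimates are made on its
   real part, which carries the same information. *)
Definition rnorm x : R := complex.Re `|x|.

Lemma normE x : `|x| = (rnorm x)%:C.
Proof. by rewrite /rnorm RRe_real// ger0_real. Qed.

Lemma rnorm_ge0 x : 0 <= rnorm x.
Proof. by have := normr_ge0 x; rewrite normE ler0c. Qed.

Lemma rnormD x y : rnorm (x + y) <= rnorm x + rnorm y.
Proof. by have := ler_normD x y; rewrite !normE -rmorphD lecR. Qed.

Lemma normcR r : `|r%:C| = `|r|%:C :> R[i].
Proof. by rewrite normc_def /= expr0n addr0 sqrtr_sqr. Qed.

Lemma rnormZ r x : rnorm (r%:C *: x) = `|r| * rnorm x.
Proof. by apply: complexI; rewrite -normE normrZ normcR normE rmorphM. Qed.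

Lemma rnorm0 : rnorm 0 = 0.
Proof. by rewrite /rnorm normr0. Qed.

Lemma rnormN x : rnorm (- x) = rnorm x.
Proof. by rewrite /rnorm normrN. Qed.

Lemma rnorm_eq0 x : rnorm x = 0 -> x = 0.
Proof. by move=> x0; apply/normr0_eq0; rewrite normE x0. Qed.

Lemma rnorm_gt0 x : x != 0 -> 0 < rnorm x.
Proof.
by move=> x0; rewrite lt_def rnorm_ge0 andbT; apply: contra_neq x0 => /rnorm_eq0.
Qed.

End RealNorm.

Section BoundedOperators.
Context (R : realType) (H : completeNormedModType R[i]).
Implicit Types (S T : H -> H) (x y : H) (c : R[i]) (r M : R).

Lemma bounded_opD T x y : bounded_op T -> T (x + y) = T x + T y.
Proof. by case=> lT _; have := lT 1 x y; rewrite !scale1r. Qed.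

Lemma bounded_op0 T : bounded_op T -> T 0 = 0.
Proof.
by move=> bT; apply/(@addrI _ (T 0)); rewrite -bounded_opD// !addr0.
Qed.

Lemma bounded_opZ T c x : bounded_op T -> T (c *: x) = c *: T x.
Proof.
by move=> bT; case: (bT) => lT _; have := lT c x 0; rewrite (bounded_op0 bT) !addr0.
Qed.

Lemma bounded_opN T x : bounded_op T -> T (- x) = - T x.
Proof. by move=> bT; rewrite -scaleN1r bounded_opZ// scaleN1r. Qed.

Lemma bounded_opB T x y : bounded_op T -> T (x - y) = T x - T y.
Proof. by move=> bT; rewrite bounded_opD// bounded_opN. Qed.

Lemma bounded_op_bound T : bounded_op T ->
  exists M, 0 <= M /\ forall x, rnorm (T x) <= M * rnorm x.
Proof.
move=> [lT cT].
pose L : {linear H -> H} :=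
  HB.pack_for {linear H -> H} T (GRing.isLinear.Build _ _ _ _ T lT).
have /linear_boundedP/pinfty_ex_gt0[M M0 hM] : bounded_near L (nbhs 0).
  by apply/linear_bounded_continuous.
have MR : M = (complex.Re M)%:C by rewrite RRe_real// gtr0_real.
exists (complex.Re M); split=> [|x]; first by rewrite -ler0c -MR ltW.
by have := hM x; rewrite !normE MR -rmorphM lecR.
Qed.

Lemma bounded_opP T M : linear T -> (forall x, rnorm (T x) <= M * rnorm x) ->
  bounded_op T.
Proof.
move=> lT hM; split=> //.
pose L : {linear H -> H} :=
  HB.pack_for {linear H -> H} T (GRing.isLinear.Build _ _ _ _ T lT).
apply: (@bounded_linear_continuous _ _ _ L); apply/linear_boundedP.
exists `|M|%:C; split; first by rewrite complex_real.
move=> y; rewrite ltcE => /andP[/eqP yi ry] x.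
have -> : y = (complex.Re y)%:C.
  by rewrite RRe_real// realE !lecE /= yi /= eqxx (le_trans _ (ltW ry))/=.
rewrite !normE -rmorphM lecR (le_trans (hM x))// ler_wpM2r ?rnorm_ge0//.
by rewrite (le_trans (ler_norm _))// ltW.
Qed.

Let unit_values T := [set complex.Re `|T x| | x in [set x : H | `|x| <= 1]].

Lemma unit_values_ubound T M : 0 <= M -> (forall x, rnorm (T x) <= M * rnorm x) ->
  ubound (unit_values T) M.
Proof.
move=> M0 hM _ [x /= x1 <-]; apply: (le_trans (hM x)).
by rewrite -[leRHS]mulr1 ler_wpM2l// -lecR -normE.
Qed.

Lemma unit_values_nonempty T : unit_values T !=set0.
Proof. by exists (rnorm (T 0)); exists 0 => //=; rewrite normr0 ler01. Qed.

Lemma opnorm_le T M : 0 <= M -> (forall x, rnorm (T x) <= M * rnorm x) ->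
  opnorm T <= M.
Proof.
move=> M0 hM; rewrite /opnorm.
exact: (ge_sup (unit_values_nonempty T) (unit_values_ubound M0 hM)).
Qed.

Lemma opnorm_ge T x : bounded_op T -> rnorm (T x) <= opnorm T * rnorm x.
Proof.
move=> bT; have [->|x0] := eqVneq x 0.
  by rewrite (bounded_op0 bT) rnorm0 mulr0.
have px := rnorm_gt0 x0; rewrite -ler_pdivrMr//.
have [M [M0 hM]] := bounded_op_bound bT.
have -> : rnorm (T x) / rnorm x = rnorm (T ((rnorm x)^-1%:C *: x)).
  by rewrite bounded_opZ// rnormZ ger0_norm ?invr_ge0 ?rnorm_ge0// mulrC.
rewrite /opnorm; apply: ub_le_sup; first by exists M; exact: unit_values_ubound.
exists ((rnorm x)^-1%:C *: x) => //=.
by rewrite normE rnormZ ger0_norm ?invr_ge0 ?rnorm_ge0// mulVf// gt_eqF.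
Qed.

Lemma opnorm_ge0 T : bounded_op T -> 0 <= opnorm T.
Proof.
move=> bT; have [M [M0 hM]] := bounded_op_bound bT.
rewrite /opnorm; apply: ub_le_sup; first by exists M; exact: unit_values_ubound.
by exists 0; rewrite /= ?normr0 ?ler01// (bounded_op0 bT) normr0.
Qed.

Lemma bounded_op_id : bounded_op (idfun : H -> H).
Proof. by apply: (@bounded_opP _ 1) => [c x y//|x]; rewrite mul1r. Qed.

Lemma bounded_op_zero : bounded_op (0 : H -> H).
Proof.
apply: (@bounded_opP _ 0) => [c x y|x]; rewrite /= ?mul0r ?rnorm0//.
by rewrite /GRing.zero /= scaler0 addr0.
Qed.

Lemma bounded_op_lin c S T : bounded_op S -> bounded_op T ->
  bounded_op (c *: S + T).
Proof.
move=> bS bT; have [M [M0 hM]] := bounded_op_bound bS.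
have [N [N0 hN]] := bounded_op_bound bT.
have E x : (c *: S + T) x = c *: S x + T x by [].
apply: (@bounded_opP _ (complex.Re `|c| * M + N)) => [d x y|x]; rewrite !E.
  rewrite (bounded_opD _ _ bS) (bounded_opD _ _ bT).
  rewrite (bounded_opZ _ _ bS) (bounded_opZ _ _ bT) !scalerDr !scalerA [d * c]mulrC.
  by rewrite addrACA.
rewrite (le_trans (rnormD _ _))// mulrDl lerD//.
have -> : rnorm (c *: S x) = complex.Re `|c| * rnorm (S x).
  by apply: complexI; rewrite rmorphM/= RRe_real ?ger0_real// -normE normrZ normE.
rewrite -mulrA ler_wpM2l//.
by have := normr_ge0 c; rewrite lecE => /andP[].
Qed.

Lemma bounded_op_comp S T : bounded_op S -> bounded_op T -> bounded_op (S \o T).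
Proof.
move=> bS bT; have [M [M0 hM]] := bounded_op_bound bS.
have [N [N0 hN]] := bounded_op_bound bT.
apply: (@bounded_opP _ (M * N)) => [d x y|x] /=.
  by rewrite (bounded_opD _ _ bT) (bounded_opZ _ _ bT) (bounded_opD _ _ bS)
    (bounded_opZ _ _ bS).
by rewrite (le_trans (hM _))// -mulrA ler_wpM2l.
Qed.

End BoundedOperators.

(** * The real inner product *)

Section RealDot.
Context (R : realType) (H : completeNormedModType R[i]).
Context (dot : {dot H for Num.conj}).
Hypothesis dot_norm : forall x : H, dot x x = `|x| ^+ 2.
Implicit Types (S T : H -> H) (x y z : H) (c : R[i]) (r M : R).

(** The real part of the inner product already determines adjoints and
   positivity, so complex conjugation can be kept out of the estimates. *)
Definition rdot x y : R := complex.Re (dot x y).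

Lemma rdotDl x y z : rdot (x + y) z = rdot x z + rdot y z.
Proof. by rewrite /rdot linearDl raddfD. Qed.

Lemma rdotDr x y z : rdot z (x + y) = rdot z x + rdot z y.
Proof. by rewrite /rdot linearDr raddfD. Qed.

Lemma dotC x y : dot x y = (dot y x)^*%C.
Proof. by rewrite hermC expr0 mul1r. Qed.

Lemma rdotC x y : rdot x y = rdot y x.
Proof. by rewrite /rdot dotC; case: (dot y x). Qed.

Lemma rdotZl r x y : rdot (r%:C *: x) y = r * rdot x y.
Proof.
rewrite /rdot linearZl_LR /=; case: (dot x y) => a b /=.
by rewrite mul0r subr0.
Qed.

Lemma rdotZr r x y : rdot x (r%:C *: y) = r * rdot x y.
Proof. by rewrite rdotC rdotZl rdotC. Qed.

Lemma rdotNl x y : rdot (- x) y = - rdot x y.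
Proof. by rewrite -scaleN1r -(rmorphN1 (real_complex R)) rdotZl mulN1r. Qed.

Lemma rdotNr x y : rdot x (- y) = - rdot x y.
Proof. by rewrite rdotC rdotNl rdotC. Qed.

Lemma rdotBl x y z : rdot (x - y) z = rdot x z - rdot y z.
Proof. by rewrite rdotDl rdotNl. Qed.

Lemma rdotBr x y z : rdot z (x - y) = rdot z x - rdot z y.
Proof. by rewrite rdotDr rdotNr. Qed.

Lemma rdotxx x : rdot x x = rnorm x ^+ 2.
Proof. by rewrite /rdot dot_norm normE -rmorphXn. Qed.

Lemma rdot_le x y : rdot x y <= rnorm x * rnorm y.
Proof.
have [->|/rnorm_gt0 x0] := eqVneq x 0.
  by rewrite -[0](subrr 0) rdotBl subrr subrr rnorm0 mul0r.
have [->|/rnorm_gt0 y0] := eqVneq y 0.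
  by rewrite -[0](subrr 0) rdotBr subrr subrr rnorm0 mulr0.
have := sqr_ge0 (rnorm ((rnorm y)%:C *: x - (rnorm x)%:C *: y)).
rewrite -rdotxx rdotBl !rdotBr !rdotZl !rdotZr !rdotxx (rdotC y x).
rewrite [X in _ <= X](_ : _ =
  2 * (rnorm x * rnorm y) * (rnorm x * rnorm y - rdot x y)); last by ring.
by rewrite pmulr_rge0 ?subr_ge0// mulr_gt0// mulr_gt0.
Qed.

Lemma rdot_abs_le x y : `|rdot x y| <= rnorm x * rnorm y.
Proof. by rewrite ler_norml lerNl -rdotNl -{1}(rnormN x) !rdot_le. Qed.

Lemma Im_dot x y : complex.Im (dot x y) = - rdot ('i *: x) y.
Proof.
rewrite /rdot linearZl_LR /=; case: (dot x y) => a b /=.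
by rewrite mul0r sub0r mul1r opprK.
Qed.

Lemma rdot_i x y : rdot ('i *: x) ('i *: y) = rdot x y.
Proof.
rewrite /rdot linearZl_LR linearZr_LR /=; case: (dot x y) => a b /=.
by rewrite !(mul0r, mul1r, sub0r, subr0, oppr0, add0r, addr0, mulN1r, opprK).
Qed.

Lemma adjoint_pairP S T : bounded_op S ->
  adjoint_pair dot S T <-> forall x y, rdot (S x) y = rdot x (T y).
Proof.
move=> bS; split=> [adj x y|adj x y]; first by rewrite /rdot adj.
apply/eqP; rewrite eq_complex; apply/andP; split; apply/eqP; first exact: adj.
by rewrite !Im_dot -adj (bounded_opZ _ _ bS).
Qed.

(** Over the complex scalars positivity entails self-adjointness: the form is
   real on the diagonal, so polarisation makes it hermitian. *)
Lemma positive_opP T : bounded_op T ->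
  positive_op dot T <-> adjoint_pair dot T T /\ forall x, 0 <= rdot (T x) x.
Proof.
move=> bT; split=> [pT|[aT pT] x]; last first.
  rewrite lecE pT andbT; apply/eqP.
  move: (dotC (T x) x) (aT x x) => + e; rewrite -e.
  by case: (dot (T x) x) => a b [/= ?]; lra.
have imT x : complex.Im (dot (T x) x) = 0 by apply: ger0_Im.
have sym x y : complex.Im (dot (T x) y) = - complex.Im (dot (T y) x).
  have := imT (x + y); rewrite (bounded_opD _ _ bT) linearDl !linearDr/= !raddfD/=.
  by rewrite !imT; lra.
split=> [|x]; last by have := pT x; rewrite lecE => /andP[].
apply/adjoint_pairP => // x y; have := sym ('i *: x) y.
rewrite (bounded_opZ _ _ bT) !Im_dot scalerA.
have -> : 'i * 'i = (-1)%:C :> R[i] by rewrite -expr2 sqr_i rmorphN1.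
by rewrite rdotZl mulN1r opprK => ->; rewrite opprK rdot_i rdotC.
Qed.

End RealDot.

(** * A von Neumann algebra as a Banach algebra *)

Section Closure.
Context (R : realType) (H : completeNormedModType R[i]).
Context (dot : {dot H for Num.conj}) (A : set (H -> H)).
Hypothesis vnA : von_neumann_algebra dot A.
Implicit Types (S T : H -> H) (x y : H) (c : R[i]) (r M : R).

Lemma vn_bounded T : A T -> bounded_op T.
Proof. by case: vnA => + _ _; exact. Qed.

(** All closure properties of [A], limits included, are obtained by checking that
   commutation with a fixed bounded operator is preserved. *)
Lemma vn_bicommutant T : bounded_op T ->
  (forall S, bounded_op S -> (forall U, A U -> S \o U = U \o S) ->
     forall x, T (S x) = S (T x)) -> A T.
Proof.
case: vnA => _ _ bicom bT hT; rewrite -bicom; split=> // S [bS hS].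
by apply/funext => x; exact: hT.
Qed.

Lemma vn_commutes T S x : A T -> bounded_op S ->
  (forall U, A U -> S \o U = U \o S) -> T (S x) = S (T x).
Proof. by move=> AT bS hS; exact/esym/(congr1 (@^~ x) (hS T AT)). Qed.

Lemma vn_id : A idfun.
Proof. by apply: vn_bicommutant => //; exact: bounded_op_id. Qed.

Lemma vn_zero : A 0.
Proof.
apply: vn_bicommutant => [|S bS _ x]; first exact: bounded_op_zero.
by rewrite /GRing.zero/= bounded_op0.
Qed.

Lemma vn_lin c S T : A S -> A T -> A (c *: S + T).
Proof.
move=> AS AT; apply: vn_bicommutant => [|U bU hU x].
  by apply: bounded_op_lin; exact: vn_bounded.
have E z : (c *: S + T) z = c *: S z + T z by [].
by rewrite !E (vn_commutes x AS)// (vn_commutes x AT)// bounded_opD// bounded_opZ.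
Qed.

Lemma vn_comp S T : A S -> A T -> A (S \o T).
Proof.
move=> AS AT; apply: vn_bicommutant => [|U bU hU x] /=.
  by apply: bounded_op_comp; exact: vn_bounded.
by rewrite (vn_commutes x AT)// (vn_commutes _ AS).
Qed.

Lemma vn_add S T : A S -> A T -> A (S + T).
Proof. by move=> AS AT; rewrite -[S]scale1r; exact: vn_lin. Qed.

Lemma vn_scale c T : A T -> A (c *: T).
Proof. by move=> AT; rewrite -[_ *: _]addr0; exact: vn_lin vn_zero. Qed.

Lemma vn_opp T : A T -> A (- T).
Proof. by move=> AT; rewrite -scaleN1r; exact: vn_scale. Qed.

End Closure.

(** The elements of [A] as a type of their own: it carries the operator product
   and the operator norm, neither of which can be attached to [H -> H]. The
   hypotheses are parameters because the structures declared below need them. *)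
Definition opalg (R : realType) (H : completeNormedModType R[i])
  (dot : {dot H for Num.conj}) (A : set (H -> H))
  (vnA : von_neumann_algebra dot A) (nz : (idfun : H -> H) <> 0) : Type :=
  {T : H -> H | A T}.

Section OpAlg.
Context (R : realType) (H : completeNormedModType R[i]).
Context (dot : {dot H for Num.conj}) (A : set (H -> H)).
Context (vnA : von_neumann_algebra dot A) (nz : (idfun : H -> H) <> 0).

Local Notation B := (opalg vnA nz).

Definition opval (a : B) : H -> H := sval a.
Arguments opval : simpl never.
Definition Opalg (T : H -> H) (AT : A T) : B := exist _ T AT.

Lemma opvalP (a : B) : A (opval a). Proof. exact: (svalP a). Qed.

Lemma opval_inj (a b : B) : opval a = opval b -> a = b.
Proof.
case: a b => [S AS] [T AT] /= E; rewrite /opval /= in E; subst T.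
by rewrite (Prop_irrelevance AS AT).
Qed.

Lemma opval_bounded (a : B) : bounded_op (opval a).
Proof. exact: vn_bounded vnA _ (opvalP a). Qed.
Hint Resolve opval_bounded : core.

HB.instance Definition _ := gen_eqMixin B.
HB.instance Definition _ := gen_choiceMixin B.

Definition opalg_zero : B := Opalg (vn_zero vnA).
Definition opalg_opp (a : B) : B := Opalg (vn_opp vnA (opvalP a)).
Definition opalg_add (a b : B) : B := Opalg (vn_add vnA (opvalP a) (opvalP b)).
Definition opalg_one : B := Opalg (vn_id vnA).
Definition opalg_mul (a b : B) : B := Opalg (vn_comp vnA (opvalP a) (opvalP b)).
Definition opalg_scale (r : R) (a : B) : B := Opalg (vn_scale vnA r%:C (opvalP a)).

Fact opalg_addA : associative opalg_add.
Proof. by move=> a b c; apply: opval_inj; exact: addrA. Qed.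
Fact opalg_addC : commutative opalg_add.
Proof. by move=> a b; apply: opval_inj; exact: addrC. Qed.
Fact opalg_add0 : left_id opalg_zero opalg_add.
Proof. by move=> a; apply: opval_inj; exact: add0r. Qed.
Fact opalg_addN : left_inverse opalg_zero opalg_opp opalg_add.
Proof. by move=> a; apply: opval_inj; exact: addNr. Qed.

HB.instance Definition _ :=
  GRing.isZmodule.Build B opalg_addA opalg_addC opalg_add0 opalg_addN.

Fact opalg_mulA : associative opalg_mul.
Proof. by move=> a b c; apply: opval_inj. Qed.
Fact opalg_mul1l : left_id opalg_one opalg_mul.
Proof. by move=> a; apply: opval_inj. Qed.
Fact opalg_mul1r : right_id opalg_one opalg_mul.
Proof. by move=> a; apply: opval_inj. Qed.
Fact opalg_mulDl : left_distributive opalg_mul opalg_add.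
Proof. by move=> a b c; apply: opval_inj. Qed.
Fact opalg_mulDr : right_distributive opalg_mul opalg_add.
Proof.
by move=> a b c; apply: opval_inj; apply/funext => x; exact: bounded_opD.
Qed.
Fact opalg_one_neq0 : opalg_one != opalg_zero.
Proof. by apply/eqP => /(congr1 opval). Qed.

HB.instance Definition _ := GRing.Zmodule_isNzRing.Build B
  opalg_mulA opalg_mul1l opalg_mul1r opalg_mulDl opalg_mulDr opalg_one_neq0.

Definition opalg_unit : pred B := fun a => `[< exists b : B, b * a = 1 /\ a * b = 1 >].
Definition opalg_inv (a : B) : B :=
  if opalg_unit a then xget a [set b : B | b * a = 1 /\ a * b = 1] else a.

Fact opalg_unitE a : opalg_unit a -> opalg_inv a * a = 1 /\ a * opalg_inv a = 1.
Proof.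
rewrite /opalg_inv => ua; rewrite ua; move: ua => /asboolP[b hb].
by case: xgetP => // /(_ b).
Qed.
Fact opalg_mulVr : {in opalg_unit, left_inverse 1 opalg_inv *%R}.
Proof. by move=> a /opalg_unitE[]. Qed.
Fact opalg_divrr : {in opalg_unit, right_inverse 1 opalg_inv *%R}.
Proof. by move=> a /opalg_unitE[]. Qed.
Fact opalg_unitP (a b : B) : b * a = 1 /\ a * b = 1 -> opalg_unit a.
Proof. by move=> h; apply/asboolP; exists b. Qed.
Fact opalg_inv_out : {in [predC opalg_unit], opalg_inv =1 id}.
Proof. by move=> a; rewrite inE /= /opalg_inv => /negPf; rewrite /in_mem /= => ->. Qed.

HB.instance Definition _ := GRing.NzRing_hasMulInverse.Build B
  opalg_mulVr opalg_divrr opalg_unitP opalg_inv_out.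

Fact opalg_scaleA r s a : opalg_scale r (opalg_scale s a) = opalg_scale (r * s) a.
Proof. by apply: opval_inj; rewrite [LHS](scalerA r%:C s%:C (opval a)) -rmorphM. Qed.
Fact opalg_scale1 : left_id 1 opalg_scale.
Proof. by move=> a; apply: opval_inj; exact: scale1r. Qed.
Fact opalg_scaleDr : right_distributive opalg_scale +%R.
Proof. by move=> r a b; apply: opval_inj; exact: scalerDr. Qed.
Fact opalg_scaleDl a : {morph opalg_scale^~ a : r s / r + s}.
Proof. move=> r s; apply: opval_inj.
by rewrite [LHS](_ : _ = (r + s)%:C *: opval a)// rmorphD; exact: scalerDl. Qed.

HB.instance Definition _ := GRing.Zmodule_isLmodule.Build R B
  opalg_scaleA opalg_scale1 opalg_scaleDr opalg_scaleDl.

Fact opalg_scaleAl (r : R) (a b : B) : r *: (a * b) = r *: a * b.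
Proof. by apply: opval_inj. Qed.
HB.instance Definition _ := GRing.Lmodule_isLalgebra.Build R B opalg_scaleAl.
Fact opalg_scaleAr (r : R) (a b : B) : r *: (a * b) = a * (r *: b).
Proof. by apply: opval_inj; apply/funext => x; exact/esym/bounded_opZ. Qed.
HB.instance Definition _ := GRing.Lalgebra_isAlgebra.Build R B opalg_scaleAr.

Lemma opvalD (a b : B) x : opval (a + b) x = opval a x + opval b x.
Proof. by []. Qed.
Lemma opvalN (a : B) x : opval (- a) x = - opval a x.
Proof. by []. Qed.
Lemma opvalB (a b : B) x : opval (a - b) x = opval a x - opval b x.
Proof. by []. Qed.
Lemma opvalM (a b : B) x : opval (a * b) x = opval a (opval b x).
Proof. by []. Qed.
Lemma opvalZ (r : R) (a : B) x : opval (r *: a) x = r%:C *: opval a x.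
Proof. by []. Qed.
Lemma opval0 x : opval (0 : B) x = 0. Proof. by []. Qed.
Lemma opval1 x : opval (1 : B) x = x. Proof. by []. Qed.

Lemma opval_le (a : B) x : rnorm (opval a x) <= opnorm (opval a) * rnorm x.
Proof. exact: opnorm_ge. Qed.

Fact opalg_normD (a b : B) :
  opnorm (opval (a + b)) <= opnorm (opval a) + opnorm (opval b).
Proof.
apply: opnorm_le => [|x]; first by rewrite addr_ge0// opnorm_ge0.
by rewrite opvalD (le_trans (rnormD _ _))// mulrDl lerD// opval_le.
Qed.

Fact opalg_normZ_le (r : R) (a : B) :
  opnorm (opval (r *: a)) <= `|r| * opnorm (opval a).
Proof.
apply: opnorm_le => [|x]; first by rewrite mulr_ge0// opnorm_ge0.
by rewrite opvalZ rnormZ -mulrA ler_wpM2l// opval_le.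
Qed.

Fact opalg_normZ (r : R) (a : B) :
  opnorm (opval (r *: a)) = `|r| * opnorm (opval a).
Proof.
have [->|r0] := eqVneq r 0.
  apply/eqP; rewrite eq_le opalg_normZ_le/= normr0 mul0r.
  exact: opnorm_ge0.
apply/eqP; rewrite eq_le opalg_normZ_le/=.
rewrite -ler_pdivlMl ?normr_gt0// -normfV.
by have := opalg_normZ_le r^-1 (r *: a); rewrite scalerA mulVf// scale1r.
Qed.

Fact opalg_norm_eq0 (a : B) : opnorm (opval a) = 0 -> a = 0.
Proof.
move=> a0; apply: opval_inj; apply/funext => x; apply: rnorm_eq0.
by apply/eqP; rewrite eq_le rnorm_ge0 andbT -(mul0r (rnorm x)) -a0 opval_le.
Qed.

HB.instance Definition _ := Lmodule_isNormed.Build R B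
  opalg_normD opalg_normZ opalg_norm_eq0.

Lemma opalg_normE (a : B) : `|a| = opnorm (opval a). Proof. by []. Qed.

Lemma opval_norm_le (a : B) x : rnorm (opval a x) <= `|a| * rnorm x.
Proof. exact: opval_le. Qed.

Lemma opalg_norm_le (a : B) M : 0 <= M ->
  (forall x, rnorm (opval a x) <= M * rnorm x) -> `|a| <= M.
Proof. exact: opnorm_le. Qed.

Lemma opalg_normM (a b : B) : `|a * b| <= `|a| * `|b|.
Proof.
apply: opalg_norm_le => [|x]; first by rewrite mulr_ge0.
rewrite opvalM (le_trans (opval_norm_le _ _))// -mulrA ler_wpM2l//.
exact: opval_norm_le.
Qed.

End OpAlg.
#[global] Hint Resolve opval_bounded : core.
Arguments opval {R H dot A vnA nz} a : simpl never.

(** A Cauchy filter of operators converges pointwise; the pointwise limit is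
   bounded because it is uniformly close to one of the operators, and it commutes
   with whatever the operators commute with. *)
Section Completeness.
Context (R : realType) (H : completeNormedModType R[i]).
Context (dot : {dot H for Num.conj}) (A : set (H -> H)).
Context (vnA : von_neumann_algebra dot A) (nz : (idfun : H -> H) <> 0).
Local Notation B := (opalg vnA nz).
Variable F : set_system B.
Hypotheses (FF : ProperFilter F) (cF : cauchy F).

Let eval x : B -> H := fun a => opval a x.

Let F_ball (e : R) : 0 < e -> exists a, \forall b \near F, `|a - b| < e.
Proof.
move=> e0; have [a ha] := (cauchyP F).1 cF e e0.
by exists a; move: ha; rewrite -ball_normE.
Qed.

Lemma opval_cauchy_cvg x : cvg (eval x @ F).
Proof.
apply/cauchy_cvgP/cauchy_exP => e e0.
have re : e = (complex.Re e)%:C by rewrite RRe_real// gtr0_real.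
have re0 : 0 < complex.Re e by rewrite -ltcR -re.
have px : 0 < rnorm x + 1 by rewrite ltr_wpDl ?rnorm_ge0.
have [a ha] := F_ball (divr_gt0 re0 px).
exists (opval a x); rewrite -ball_normE /fmap /=.
apply: filterS ha => b ab /=; rewrite -opvalB normE re ltcR.
apply: (le_lt_trans (opval_norm_le _ _)).
rewrite (@le_lt_trans _ _ (`|a - b| * (rnorm x + 1)))//.
  by rewrite ler_wpM2l// lerDl.
by rewrite -ltr_pdivlMr.
Qed.

Let L x : H := lim (eval x @ F).

Let L_cvg x : eval x @ F --> L x. Proof. exact: opval_cauchy_cvg. Qed.

Let L_near x (e : R) : 0 < e -> \forall b \near F, rnorm (L x - opval b x) < e.
Proof.
move=> e0; have /cvgrPdist_lt/(_ e%:C) := @L_cvg x.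
rewrite ltcR => /(_ e0); apply: filterS => b; by rewrite normE ltcR.
Qed.

Let L_le (a : B) (e : R) : 0 <= e -> (\forall b \near F, `|a - b| <= e) ->
  forall x, rnorm (opval a x - L x) <= e * rnorm x.
Proof.
move=> e0 ha x; apply/ler_addgt0Pr => d d0.
have [b [ab Lb]] := filter_ex (filterI ha (L_near x d0)).
have -> : opval a x - L x = (opval a x - opval b x) - (L x - opval b x).
  by rewrite opprB addrA subrK.
rewrite (le_trans (rnormD _ _))// rnormN lerD// ?(ltW Lb)//.
by rewrite -opvalB (le_trans (opval_norm_le _ _))// ler_wpM2r ?rnorm_ge0.
Qed.

Let L_linear : linear L.
Proof.
move=> c x y.
have h : eval (c *: x + y) @ F --> c *: L x + L y.
  rewrite (_ : eval _ = fun b => c *: eval x b + eval y b).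
    by apply: cvgD; [apply: cvgZr|]; exact: L_cvg.
  by apply/funext => b; rewrite /eval bounded_opD// bounded_opZ.
exact: (cvg_unique (@norm_hausdorff _ _) (@L_cvg _) h).
Qed.

Let L_bounded : bounded_op L.
Proof.
have [a ha] := F_ball (@ltr01 R).
have {}ha : \forall b \near F, `|a - b| <= 1 by apply: filterS ha => b /ltW.
apply: (@bounded_opP _ _ _ (`|a| + 1)) => // x.
have -> : L x = opval a x - (opval a x - L x) by rewrite opprB addrC subrK.
rewrite (le_trans (rnormD _ _))// rnormN mulrDl lerD ?opval_norm_le//.
exact: L_le.
Qed.

Let L_A : A L.
Proof.
apply: (vn_bicommutant vnA) => // S bS hS x.
have h : eval (S x) @ F --> S (L x).
  rewrite (_ : eval _ = S \o eval x).
    by apply: (@cvg_comp _ _ _ _ S) (@L_cvg x) _; case: bS => _; exact.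
  by apply/funext => b; exact: (vn_commutes x (opvalP b) bS hS).
exact: (cvg_unique (@norm_hausdorff _ _) (@L_cvg _) h).
Qed.

Lemma opalg_complete : cvg F.
Proof.
apply/cvg_ex; exists (Opalg vnA nz L_A); apply/cvgrPdist_lt => e e0.
have e2 : 0 < e / 2 by rewrite divr_gt0.
have [a ha] := F_ball e2.
have aL : `|Opalg vnA nz L_A - a| <= e / 2.
  rewrite distrC; apply: opalg_norm_le => [|x]; first exact: ltW.
  by rewrite opvalB; apply: L_le; [exact: ltW|apply: filterS ha => b /ltW].
apply: filterS ha => b ab.
by rewrite (le_lt_trans (ler_distD a _ _))// [e]splitr ler_ltD.
Qed.

End Completeness.

HB.instance Definition _ (R : realType) (H : completeNormedModType R[i])
  (dot : {dot H for Num.conj}) (A : set (H -> H))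
  (vnA : von_neumann_algebra dot A) (nz : (idfun : H -> H) <> 0) :=
  Uniform_isComplete.Build (opalg vnA nz) (@opalg_complete _ _ _ _ vnA nz).

(** * Square roots, inverses and Sylvester equations *)

Lemma fixed_point (R : realType) (X : completeNormedModType R) (U : set X)
    (f : X -> X) (q : R) :
  0 <= q -> q < 1 -> closed U -> U !=set0 -> (forall x, U x -> U (f x)) ->
  (forall x y, U x -> U y -> `|f x - f y| <= q * `|x - y|) ->
  exists2 p, U p & p = f p.
Proof.
move=> q0 q1 cU U0 fU fq.
have hf : set_fun U U f by move=> x; exact: fU.
pose F : {fun U >-> U} := mkfun hf.
apply: (@banach_fixed_point _ _ _ F) => //.
exists (NngNum q0); split=> // -[x y] [/= Ux Uy].
exact: fq.
Qed.

Section Algebra.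
Context (R : realType) (H : completeNormedModType R[i]).
Context (dot : {dot H for Num.conj}).
Hypothesis dot_norm : forall x : H, dot x x = `|x| ^+ 2.
Context (A : set (H -> H)).
Context (vnA : von_neumann_algebra dot A) (nz : (idfun : H -> H) <> 0).
Local Notation B := (opalg vnA nz).
Implicit Types (a b x y s : B) (m c : R).

(** [gap m a] says that [a] is at least [m], in terms of the norm alone: for
   self-adjoint [a] the inequality places the spectrum in [[m, 2 c - m]]. *)
Definition gap m a := exists c, `|c%:A - a| <= c - m.

Lemma gap_const m a : gap m a -> exists2 c, m <= c & `|c%:A - a| <= c - m.
Proof. by move=> [c hc]; exists c => //; rewrite -subr_ge0 (le_trans _ hc). Qed.

(** The scalar parts of the two coefficients dominate the remainders, which
   makes the Sylvester operator [x |-> a x + x b] bounded below. *)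
Lemma sylvester_lower_bound m1 m2 a b x : gap m1 a -> gap m2 b ->
  (m1 + m2) * `|x| <= `|a * x + x * b|.
Proof.
move=> [c1 h1] [c2 h2].
have E : (c1 + c2) *: x = (a * x + x * b) + (c1%:A - a) * x + x * (c2%:A - b).
  by rewrite mulrBl mulrBr -scalerAl -scalerAr mul1r mulr1 scalerDl; nc_ring.
have := ler_norm (c1 + c2).
move=> /(ler_wpM2r (normr_ge0 x)); rewrite -normrZ E => h.
have h3 : `|a * x + x * b + (c1%:A - a) * x + x * (c2%:A - b)| <=
   `|a * x + x * b| + (c1 - m1) * `|x| + (c2 - m2) * `|x|.
  rewrite (le_trans (ler_normD _ _))// lerD// ?(le_trans (ler_normD _ _))// ?lerD//.
    by rewrite (le_trans (opalg_normM _ _))// ler_wpM2r.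
  by rewrite (le_trans (opalg_normM _ _))// mulrC ler_wpM2r.
have := le_trans h h3; lra.
Qed.

(** The case of the coefficient [0], which satisfies [gap 0]. *)
Lemma lmul_lower_bound m a x : gap m a -> m * `|x| <= `|a * x|.
Proof.
move=> ga; have := @sylvester_lower_bound m 0 a 0 x ga.
rewrite mulr0 !addr0; apply; exists 0.
by rewrite scale0r subrr normr0 subrr.
Qed.

(** A right inverse is the fixed point of a contraction; the lower bound makes
   left multiplication by [a] injective, so it is also a left inverse. *)
Lemma gap_unit m a : 0 < m -> gap m a -> a \is a GRing.unit.
Proof.
move=> m0 ga; have [c mc hc] := gap_const ga.
have c0 : 0 < c by exact: lt_le_trans mc.
have [x _ fx] : exists2 x : B, setT x & x = x + c^-1 *: (1 - a * x).
  apply: (@fixed_point _ _ _ _ ((c - m) / c)) => //.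
  - by rewrite divr_ge0 ?subr_ge0// ltW.
  - by rewrite ltr_pdivrMr// mul1r; lra.
  - by exists 0.
  move=> x y _ _.
  have -> : x + c^-1 *: (1 - a * x) - (y + c^-1 *: (1 - a * y)) =
     c^-1 *: ((c%:A - a) * (x - y)).
    have E (z : B) : z = c^-1 *: (c *: z) by rewrite scalerA mulVf ?gt_eqF// scale1r.
    rewrite {1}(E x) {1}(E y) -!scalerDr -scalerBr; congr (_ *: _).
    by rewrite mulrBl -scalerAl mul1r scalerBr; nc_ring.
  rewrite normrZ gtr0_norm ?invr_gt0// [_ / c]mulrC -mulrA.
  rewrite ler_wpM2l ?invr_ge0 ?(ltW c0)//.
  by rewrite (le_trans (opalg_normM _ _))// ler_wpM2r.
have ax : a * x = 1.
  have /eqP : c^-1 *: (1 - a * x) = 0 by apply: (addrI x); rewrite -fx addr0.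
  by rewrite scaler_eq0 invr_eq0 gt_eqF//= subr_eq0 => /eqP.
apply/unitrP; exists x; split=> //; apply/eqP; rewrite -subr_eq0 -normr_eq0.
have := lmul_lower_bound (x * a - 1) ga.
rewrite mulrBr mulrA ax mul1r mulr1 subrr normr0 pmulr_rle0// => h.
by rewrite eq_le h normr_ge0.
Qed.

(** With [a = c - r] the equation reads [2 c x = y + r x + x r], where
   [|r| <= c - m], so [x] is the fixed point of a contraction. *)
Lemma sylvester_solution m a y : 0 < m -> gap m a -> exists x, a * x + x * a = y.
Proof.
move=> m0 ga; have [c mc hc] := gap_const ga.
have c0 : 0 < c by exact: lt_le_trans mc.
have c2 : c + c != 0 by rewrite gt_eqF// addr_gt0.
have [x _ fx] : exists2 x : B, setT x & x = x + (c + c)^-1 *: (y - (a * x + x * a)).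
  apply: (@fixed_point _ _ _ _ ((c - m) / c)) => //.
  - by rewrite divr_ge0 ?subr_ge0// ltW.
  - by rewrite ltr_pdivrMr// mul1r; lra.
  - by exists 0.
  move=> x z _ _.
  have -> : x + (c + c)^-1 *: (y - (a * x + x * a)) -
            (z + (c + c)^-1 *: (y - (a * z + z * a))) =
     (c + c)^-1 *: ((c%:A - a) * (x - z) + (x - z) * (c%:A - a)).
    have E (u : B) : u = (c + c)^-1 *: ((c + c) *: u).
      by rewrite scalerA mulVf// scale1r.
    rewrite {1}(E x) {1}(E z) -!scalerDr -scalerBr !scalerDl; congr (_ *: _).
    rewrite (mulrBl (x - z)) (mulrBr (x - z)) -scalerAl -scalerAr mul1r mulr1.
    by rewrite scalerBr; nc_ring.
  rewrite normrZ gtr0_norm ?invr_gt0 ?addr_gt0//.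
  rewrite ler_pdivrMl ?addr_gt0//.
  have -> : (c + c) * ((c - m) / c * `|x - z|) =
      (c - m) * `|x - z| + (c - m) * `|x - z|.
    by field; rewrite gt_eqF.
  rewrite (le_trans (ler_normD _ _))// lerD// (le_trans (opalg_normM _ _))//.
    by rewrite ler_wpM2r.
  by rewrite mulrC ler_wpM2r.
exists x; have /eqP : (c + c)^-1 *: (y - (a * x + x * a)) = 0.
  by apply: (addrI x); rewrite -fx addr0.
by rewrite scaler_eq0 invr_eq0 (negPf c2)/= subr_eq0 => /eqP.
Qed.

End Algebra.

(** * Self-adjoint elements and the positive cone *)

Section Cone.
Context (R : realType) (H : completeNormedModType R[i]).
Context (dot : {dot H for Num.conj}).
Hypothesis dot_norm : forall x : H, dot x x = `|x| ^+ 2.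
Context (A : set (H -> H)).
Context (vnA : von_neumann_algebra dot A) (nz : (idfun : H -> H) <> 0).
Local Notation B := (opalg vnA nz).
Implicit Types (a b s : B) (x y : H) (m c r : R).

(** Adjointness is used as a relation: no adjoint ever has to be chosen. *)
Definition adj a b := adjoint_pair dot (opval a) (opval b).
Definition sa a := adj a a.

Lemma adjP a b :
  adj a b <-> forall x y, rdot dot (opval a x) y = rdot dot x (opval b y).
Proof. exact: adjoint_pairP. Qed.

Lemma adj_sym a b : adj a b -> adj b a.
Proof. by move=> /adjP h; apply/adjP => x y; rewrite rdotC -h rdotC. Qed.

Lemma adjD a b a' b' : adj a b -> adj a' b' -> adj (a + a') (b + b').
Proof.
by move=> /adjP h /adjP h'; apply/adjP => x y; rewrite !opvalD rdotDl rdotDr h h'.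
Qed.

Lemma adjN a b : adj a b -> adj (- a) (- b).
Proof. by move=> /adjP h; apply/adjP => x y; rewrite !opvalN rdotNl rdotNr h. Qed.

Lemma adjB a b a' b' : adj a b -> adj a' b' -> adj (a - a') (b - b').
Proof. by move=> h h'; apply: adjD => //; exact: adjN. Qed.

Lemma adjM a b a' b' : adj a b -> adj a' b' -> adj (a * a') (b' * b).
Proof. by move=> /adjP h /adjP h'; apply/adjP => x y; rewrite !opvalM h h'. Qed.

Lemma adjZ r a b : adj a b -> adj (r *: a) (r *: b).
Proof. by move=> /adjP h; apply/adjP => x y; rewrite !opvalZ rdotZl rdotZr h. Qed.

Lemma adj0 : adj 0 0.
Proof. by apply/adjP => x y; rewrite !opval0 -(subrr (0 : H)) rdotBl rdotBr !subrr. Qed.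

Lemma adj1 : adj 1 1.
Proof. by apply/adjP => x y. Qed.

Lemma adj_ex a : exists b, adj a b.
Proof.
have [_ star _] := vnA; have [S AS h] := star _ (opvalP a).
by exists (Opalg vnA nz AS).
Qed.

Lemma saV a : a \is a GRing.unit -> sa a -> sa a^-1.
Proof.
move=> ua /adjP h; apply/adjP => x y.
have E z : z = opval a (opval a^-1 z) by rewrite -opvalM divrr.
by rewrite {2}(E x) h -opvalM divrr// [in LHS](E y) opvalM -opvalM divrr.
Qed.

Lemma sa_congr a b : sa a -> sa b -> sa (a * b * a).
Proof. by move=> sA sB; rewrite /sa -{2}mulrA; apply: adjM => //; apply: adjM. Qed.

Lemma closed_sa : closed [set a : B | sa a].
Proof.
move=> a ca; apply/adjP => x y; apply/eqP; rewrite -subr_eq0 -normr_le0.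
apply/ler_addgt0Pr => e e0; rewrite add0r.
pose N := rnorm x * rnorm y + 1.
have N0 : 0 < N by rewrite ltr_wpDl// mulr_ge0// rnorm_ge0.
have [|b [/adjP sb]] := ca (ball a (e / (2 * N))).
  by apply: nbhsx_ballx; rewrite divr_gt0// mulr_gt0.
rewrite -ball_normE /= => ab.
have -> : rdot dot (opval a x) y - rdot dot x (opval a y) =
  rdot dot (opval (a - b) x) y - rdot dot x (opval (a - b) y).
  by rewrite !opvalB rdotBl rdotBr sb; ring.
rewrite (le_trans (ler_normB _ _))//.
have h z w : `|rdot dot (opval (a - b) z) w| <= `|a - b| * (rnorm z * rnorm w).
  rewrite mulrA (le_trans (rdot_abs_le dot_norm _ _))// ler_wpM2r ?rnorm_ge0//.
  exact: opval_norm_le.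
have := lerD (h x y) (h y x); rewrite (rdotC dot _ x) => /le_trans; apply.
rewrite (mulrC (rnorm y)) -mulr2n -mulr_natl mulrA.
apply: (@le_trans _ _ (2 * (e / (2 * N)) * N)).
  apply: ler_pM; rewrite ?mulr_ge0 ?rnorm_ge0 ?ler_pM2l ?(ltW ab)//.
  by rewrite /N lerDl.
rewrite le_eqVlt; apply/orP; left; apply/eqP; field.
by rewrite gt_eqF.
Qed.

(** For [c (1 - t)] the root is [sqrt c (1 - y)], where [y] solves
   [y = (t + y^2) / 2]: a contraction on any ball of radius [rho < 1] that
   contains [t]. *)
Lemma gap_sqrt m a : 0 < m -> gap m a -> sa a ->
  exists s, [/\ sa s, s * s = a & exists2 m', 0 < m' & gap m' s].
Proof.
move=> m0 ga saa; have [c mc hc] := gap_const ga.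
have c0 : 0 < c by exact: lt_le_trans mc.
pose rho := (c - m) / c.
have rho0 : 0 <= rho by rewrite divr_ge0 ?subr_ge0// ltW.
have rho1 : rho < 1 by rewrite ltr_pdivrMr// mul1r; lra.
pose t : B := 1 - c^-1 *: a.
have sat : sa t by apply: adjB adj1 _; exact: adjZ.
have tE : t = c^-1 *: (c%:A - a) by rewrite scalerBr scalerA mulVf ?gt_eqF// scale1r.
have t_le : `|t| <= rho.
  by rewrite tE normrZ gtr0_norm ?invr_gt0// mulrC ler_wpM2r// invr_ge0 ltW.
have [y [say y_le] fy] : exists2 y : B, (sa y /\ `|y| <= rho) & y = 2^-1 *: (t + y * y).
  apply: (@fixed_point _ _ [set y : B | sa y /\ `|y| <= rho] _ rho) => //.
  - apply: closedI; first exact: closed_sa.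
    apply: (preimage_closed _ (@closed_le _ rho)) => y _.
    exact: norm_continuous.
  - by exists 0; split; [exact: adj0|rewrite normr0].
  - move=> y [say y_le]; split; first by apply: adjZ; apply: adjD => //; exact: adjM.
    rewrite normrZ gtr0_norm ?invr_gt0// ler_pdivrMl//.
    rewrite (le_trans (ler_normD _ _))// mulr_natl mulr2n lerD//.
    rewrite (le_trans (opalg_normM _ _))// (le_trans (ler_pM _ _ y_le y_le))//.
    exact: ler_piMr rho0 (ltW rho1).
  move=> y z [_ y_le] [_ z_le].
  rewrite -scalerBr normrZ gtr0_norm ?invr_gt0// ler_pdivrMl//.
  have -> : t + y * y - (t + z * z) = y * (y - z) + (y - z) * z by nc_ring.
  rewrite (le_trans (ler_normD _ _))// mulr_natl mulr2n lerD//.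
    by rewrite (le_trans (opalg_normM _ _))// ler_wpM2r.
  by rewrite (le_trans (opalg_normM _ _))// mulrC ler_wpM2r.
pose q := Num.sqrt c.
have q0 : 0 < q by rewrite sqrtr_gt0.
exists (q *: (1 - y)); split.
- by apply: adjZ; apply: adjB => //; exact: adj1.
- rewrite -scalerAl -scalerAr scalerA -expr2 sqr_sqrtr ?(ltW c0)//.
  have h : y + y = t + y * y.
    by rewrite -mulr2n -scaler_nat {1}fy scalerA divff ?pnatr_eq0// scale1r.
  have -> : (1 - y) * (1 - y) = 1 - (y + y) + y * y by nc_ring.
  have -> : 1 - (y + y) + y * y = 1 - t by rewrite h; nc_ring.
  by rewrite /t opprB addrC subrK scalerA divff ?gt_eqF// scale1r.
exists (q * (1 - rho)); first by rewrite mulr_gt0// subr_gt0.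
exists q; rewrite -scalerBr opprB addrC subrK normrZ gtr0_norm//.
by rewrite mulrBr mulr1 opprB addrC subrK ler_wpM2l// ltW.
Qed.

Definition cone a := positive_cone dot A (opval a).

Definition pos a := positive_op dot (opval a).

Lemma posP a : pos a <-> sa a /\ forall x, 0 <= rdot dot (opval a x) x.
Proof. exact: positive_opP. Qed.

Lemma coneP a : cone a <-> pos a /\ a \is a GRing.unit.
Proof.
split=> [[_ pa [T [AT aT Ta]]]|[pa ua]].
  split=> //; apply/unitrP; exists (Opalg vnA nz AT).
  by split; apply: opval_inj.
split=> //; first exact: opvalP.
exists (opval a^-1); split; first exact: opvalP.
  by apply/funext => x; rewrite /= -opvalM divrr.
by apply/funext => x; rewrite /= -opvalM mulVr.
Qed.

Lemma cone_sa a : cone a -> sa a. Proof. by move=> /coneP[/posP[]]. Qed.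
Lemma cone_unit a : cone a -> a \is a GRing.unit. Proof. by move=> /coneP[]. Qed.

Lemma cone_op_inv a : cone a -> op_inv (opval a) = opval a^-1.
Proof.
move=> /cone_unit ua; rewrite /op_inv; case: xgetP => [S -> [aS Sa]|/(_ (opval a^-1))].
  apply/funext => x; have := congr1 (@^~ (opval a^-1 x)) Sa => /= <-.
  by rewrite -opvalM divrr.
case; split; apply/funext => x; first by rewrite /= -opvalM divrr.
by rewrite /= -opvalM mulVr.
Qed.

(** Cauchy-Schwarz for the form of [a], at the single pair [x], [a x]. *)
Lemma pos_sqr_le a r x : pos a -> 0 < r ->
  (forall y, rdot dot (opval a y) y <= r * rnorm y ^+ 2) ->
  rnorm (opval a x) ^+ 2 <= r * rdot dot (opval a x) x.
Proof.
move=> /posP[/adjP sA pA] r0 ha; set y := opval a x.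
have rV0 : 0 < r^-1 by rewrite invr_gt0.
(* the value at [- r^-1] minimises the bound on the quadratic polynomial
   [t |-> <a (x + t y), x + t y>] *)
have := pA (x - (r^-1)%:C *: y); rewrite bounded_opB// bounded_opZ//.
rewrite rdotBl !rdotBr !rdotZl !rdotZr -/y [rdot _ (opval a y) x]sA -/y.
have := ha y; rewrite -ler_pdivrMl// !rdotxx// => h1 h2.
rewrite -ler_pdivrMl//; have := ler_wpM2l (ltW rV0) h1; move: h2; lra.
Qed.

(** [pos_sqr_le] is used twice: for [a], to get [m <= a] from
   [|x| <= |a^-1| |a x|], and for [p = |a| + m - a], whose form lies between [0]
   and [|a|], to get [|p| <= |a|]. *)
Lemma cone_gap_norm a : cone a -> 0 < `|a| * `|a^-1| ^+ 2 /\
  gap (`|a| * `|a^-1| ^+ 2)^-1 a.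
Proof.
move=> /coneP[pa ua]; have /posP[saa pA] := pa.
have an0 : a != 0 by apply: contraTneq ua => ->; rewrite unitr0.
have a0 : 0 < `|a| by rewrite normr_gt0.
have b0 : 0 < `|a^-1| by rewrite normr_gt0 invr_eq0.
split; first by rewrite mulr_gt0// exprn_gt0.
set m := (`|a| * `|a^-1| ^+ 2)^-1.
have m0 : 0 < m by rewrite invr_gt0 mulr_gt0// exprn_gt0.
exists (`|a| + m); rewrite addrK.
have le1 x : rdot dot (opval a x) x <= `|a| * rnorm x ^+ 2.
  rewrite (le_trans (rdot_le dot_norm _ _))// expr2 mulrA ler_wpM2r ?rnorm_ge0//.
  exact: opval_norm_le.
have le2 x : m * rnorm x ^+ 2 <= rdot dot (opval a x) x.
  rewrite ler_pdivrMl ?mulr_gt0 ?exprn_gt0//.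
  have h1 := pos_sqr_le x pa a0 le1.
  have h2 : rnorm x <= `|a^-1| * rnorm (opval a x).
    have {1}-> : x = opval a^-1 (opval a x) by rewrite -opvalM mulVr.
    exact: opval_norm_le.
  have h3 : rnorm x ^+ 2 <= (`|a^-1| * rnorm (opval a x)) ^+ 2.
    by rewrite ler_sqr// nnegrE ?mulr_ge0// rnorm_ge0.
  rewrite (le_trans h3)// exprMn [`|a| * `|_| ^+ 2]mulrC -[leRHS]mulrA.
  by rewrite ler_wpM2l ?exprn_ge0.
set p := (`|a| + m)%:A - a.
have rp x : rdot dot (opval p x) x = (`|a| + m) * rnorm x ^+ 2 - rdot dot (opval a x) x.
  by rewrite opvalB opvalZ opval1 rdotBl rdotZl rdotxx.
have pp : pos p.
  apply/posP; split; first by apply: adjB => //; apply: adjZ; exact: adj1.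
  move=> x; rewrite rp subr_ge0 (le_trans (le1 x))// ler_wpM2r ?exprn_ge0 ?rnorm_ge0//.
  by rewrite lerDl ltW.
have le3 x : rdot dot (opval p x) x <= `|a| * rnorm x ^+ 2.
  by rewrite rp mulrDl; have := le2 x; lra.
apply: opalg_norm_le => // x.
rewrite -ler_sqr ?nnegrE ?mulr_ge0 ?rnorm_ge0//.
rewrite (le_trans (pos_sqr_le x pp a0 le3))// exprMn [in leRHS]expr2 -mulrA.
by rewrite ler_wpM2l.
Qed.

Lemma cone_gap a : cone a -> exists2 m, 0 < m & gap m a.
Proof.
by move=> /cone_gap_norm[m0 ga]; exists (`|a| * `|a^-1| ^+ 2)^-1; rewrite ?invr_gt0.
Qed.

Lemma gap_cone m a : 0 < m -> gap m a -> sa a -> cone a.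
Proof.
move=> m0 ga saa; apply/coneP; split; last exact: gap_unit ga.
apply/posP; split=> // x; have [c mc hc] := gap_const ga.
have h : rdot dot (opval (c%:A - a) x) x <= (c - m) * rnorm x ^+ 2.
  rewrite (le_trans (rdot_le dot_norm _ _))// expr2 mulrA ler_wpM2r ?rnorm_ge0//.
  by rewrite (le_trans (opval_norm_le _ _))// ler_wpM2r ?rnorm_ge0.
move: h; rewrite opvalB opvalZ opval1 rdotBl rdotZl rdotxx//.
have := mulr_ge0 (ltW m0) (exprn_ge0 2 (rnorm_ge0 x)); lra.
Qed.

Lemma cone_sqrt a : cone a -> exists s, cone s /\ s * s = a.
Proof.
move=> ca; have [m m0 ga] := cone_gap ca.
have [s [ss sa [m' m'0 gs]]] := gap_sqrt m0 ga (cone_sa ca).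
by exists s; split=> //; exact: gap_cone gs ss.
Qed.

Lemma cone_congr g a : sa g -> g \is a GRing.unit -> cone a -> cone (g * a * g).
Proof.
move=> sg ug /coneP[/posP[saa pA] ua]; apply/coneP; split; last first.
  by rewrite !unitrMl.
apply/posP; split; first exact: sa_congr.
by move=> x; rewrite !opvalM; move/adjP: sg => ->; exact: pA.
Qed.

Lemma sqrt_unique a s : cone a -> cone s -> a * a = s * s -> a = s.
Proof.
move=> ca cs E; apply/eqP; rewrite -subr_eq0 -normr_le0.
have [m1 m10 g1] := cone_gap ca; have [m2 m20 g2] := cone_gap cs.
have := sylvester_lower_bound (a - s) g1 g2.
rewrite (_ : a * (a - s) + _ = a * a - s * s); last by nc_ring.
by rewrite E subrr normr0 pmulr_rle0// addr_gt0.
Qed.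

Lemma gap_segment m a b r : gap m a -> gap m b -> 0 <= r <= 1 ->
  gap m (a + r *: (b - a)).
Proof.
move=> [c1 g1] [c2 g2] /andP[r0 r1]; have r1' : 0 <= 1 - r by rewrite subr_ge0.
exists ((1 - r) * c1 + r * c2).
have -> : ((1 - r) * c1 + r * c2)%:A - (a + r *: (b - a)) =
    (1 - r) *: (c1%:A - a) + r *: (c2%:A - b).
  by rewrite !scalerBr !scalerA scalerDl [(1 - r) *: a]scalerBl scale1r; nc_ring.
rewrite (le_trans (ler_normD _ _))// !normrZ !ger0_norm//.
have := ler_wpM2l r1' g1; have := ler_wpM2l r0 g2; lra.
Qed.

Lemma gap_weaken m n a : n <= m -> gap m a -> gap n a.
Proof. by move=> nm [c h]; exists c; move: nm h; lra. Qed.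

Lemma inv_norm_le m a : 0 < m -> gap m a -> `|a^-1| <= m^-1.
Proof.
move=> m0 ga; rewrite -[leRHS]mulr1 ler_pdivlMl//.
apply: (le_trans (lmul_lower_bound a^-1 ga)); rewrite divrr; last exact: gap_unit ga.
by apply: opalg_norm_le => // x; rewrite opval1 mul1r.
Qed.

End Cone.

(** * Differentiation relative to an interval *)

Section Derivative.
Context (R : realType) (V : normedModType R).
Implicit Types (J : set R) (f g : R -> V) (s t : R) (v w : V).

(** Relative to [J], so that an endpoint is not a special case. *)
Definition deriv J f t v := (s - t)^-1 *: (f s - f t) @[s --> within J t^'] --> v.

Lemma deriv_sub J K f t v : K `<=` J -> deriv J f t v -> deriv K f t v.
Proof. by move=> KJ; apply: cvg_trans; apply: cvg_app; exact: within_subset. Qed.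

Lemma deriv_cvg J f t v : deriv J f t v -> f s @[s --> within J t^'] --> f t.
Proof.
move=> df; have h : (s - t) *: ((s - t)^-1 *: (f s - f t)) @[s --> within J t^'] -->
    (0 : R) *: v.
  apply: cvgZ df; apply: cvg_within_filter; apply: cvg_within_filter.
  by apply/subr_cvg0; exact: cvg_id.
apply/subr_cvg0; rewrite scale0r in h; apply: cvg_trans h; apply: near_eq_cvg.
apply: cvg_within; near=> s; rewrite scalerA divff ?scale1r// subr_eq0.
by near: s; exact: nbhs_dnbhs_neq.
Unshelve. all: by end_near. Qed.

Lemma within_punctured J f t : f s @[s --> within J t^'] --> f t ->
  f s @[s --> within J (nbhs t)] --> f t.
Proof.
move=> /cvgrPdist_lt h; apply/cvgrPdist_lt => e e0.
have := h e e0; rewrite !near_withinE; apply: filterS => s hs Js.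
have [->|st] := eqVneq s t; first by rewrite subrr normr0.
exact: hs.
Qed.

Lemma deriv_cont J f t v : deriv J f t v -> f s @[s --> within J (nbhs t)] --> f t.
Proof. by move=> /deriv_cvg/within_punctured. Qed.

Lemma deriv_affine J v w t : deriv J (fun s => v + s *: w) t w.
Proof.
rewrite /deriv; apply: (@cvg_trans _ ((fun=> w) @ within J t^')); last exact: cvg_cst.
apply: near_eq_cvg; apply: cvg_within; near=> s.
rewrite opprD addrACA subrr add0r -scalerBl scalerA mulVf ?scale1r// subr_eq0.
by near: s; exact: nbhs_dnbhs_neq.
Unshelve. all: by end_near. Qed.

Lemma deriv_cst J v t : deriv J (fun=> v) t 0.
Proof.
have := @deriv_affine J v 0 t; rewrite (_ : (fun s => _) = fun=> v)//.
by apply/funext => s; rewrite scaler0 addr0.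
Qed.

(** At a maximiser [c] of [|f t - f a| - e (t - a)], moving slightly to the left
   would gain more from [- e (t - a)] than it can lose from [f], so [c = a]. *)
Lemma deriv0_const f (a b : R) : a <= b ->
  (forall t, `[a, b]%classic t -> deriv `[a, b]%classic f t 0) -> f b = f a.
Proof.
move=> ab df; apply/eqP; rewrite -subr_eq0 -normr_le0.
apply/ler_addgt0Pr => e e0; rewrite add0r.
pose d := e / (b - a + 1).
have ba0 : 0 < b - a + 1 by rewrite ltr_wpDl ?subr_ge0.
have d0 : 0 < d by rewrite divr_gt0.
pose phi t := `|f t - f a| - d * (t - a).
have cphi : {within `[a, b], continuous phi}.
  apply/subspace_continuousP => t tab; apply: cvgB.
    apply: cvg_norm; apply: cvgB; last exact: cvg_cst.
    exact: deriv_cont (df _ tab).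
  apply: cvgM; first exact: cvg_cst.
  apply: cvgB; last exact: cvg_cst.
  by apply: cvg_within_filter; exact: cvg_id.
have [c cab cmax] := EVT_max ab cphi.
have ca : c = a.
  apply/eqP; rewrite eq_le; move: (cab); rewrite in_itv/= => /andP[-> cb].
  rewrite andbT leNgt; apply/negP => ac.
  have /cvgr0Pnorm_lt/(_ _ d0) := df c cab.
  rewrite /dnbhs !near_withinE => /nbhs_ballP[r /= r0 hr].
  pose t := Num.max a (c - r / 2).
  have tc : t < c by rewrite gt_max ac/= ltrBlDr ltrDl divr_gt0.
  have at_ : a <= t by rewrite le_max lexx.
  have tab : `[a, b]%classic t by rewrite /= in_itv/= at_ (le_trans (ltW tc)).
  have : ball c r t.
    rewrite /ball/= ger0_norm ?subr_ge0 ?(ltW tc)//.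
    have : c - r / 2 <= t by rewrite le_max lexx orbT.
    lra.
  move=> /hr/(_ _ tab); rewrite lt_eqF// => /(_ isT).
  rewrite normrZ normfV distrC (gtr0_norm (_ : 0 < c - t)) ?subr_gt0//.
  rewrite ltr_pdivrMl ?subr_gt0// => h.
  have := cmax t; rewrite in_itv /= => /(_ tab); rewrite /phi.
  have := ler_distD (f t) (f c) (f a); rewrite [`|f c - f t|]distrC; move: h; lra.
have bab : b \in `[a, b] by rewrite in_itv/= ab lexx.
have := cmax b bab; rewrite /phi ca !subrr normr0 mulr0 subr0 subr_le0.
move=> /le_trans; apply; rewrite /d mulrAC ler_pdivrMr// ler_pM2l//.
by rewrite lerDl.
Qed.

Lemma deriv_reflect f (a b t : R) v :
  deriv `[a, b]%classic f (a + b - t) v ->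
  deriv `[a, b]%classic (fun s => f (a + b - s)) t (- v).
Proof.
move=> df; rewrite /deriv; apply/cvgrPdist_lt => e e0.
move/cvgrPdist_lt: df => /(_ e e0); rewrite /dnbhs !near_withinE.
move=> /nbhs_ballP[r /= r0 hr]; apply/nbhs_ballP; exists r => //= s.
rewrite /ball/= => ts st; rewrite in_itv/= => /andP[as_ sb].
have := hr (a + b - s); rewrite /ball/= opprB addrC addrA subrK distrC => /(_ ts).
rewrite (inj_eq (addrI _)) eqr_opp => /(_ st); rewrite in_itv/=.
have -> : a <= a + b - s <= b by apply/andP; split; lra.
move=> /(_ isT); rewrite -normrN.
rewrite (_ : a + b - s - (a + b - t) = - (s - t)); last by ring.
by rewrite invrN scaleNr opprD opprK.
Qed.

End Derivative.

Section Calculus.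
Context (R : realType) (H : completeNormedModType R[i]).
Context (dot : {dot H for Num.conj}).
Hypothesis dot_norm : forall x : H, dot x x = `|x| ^+ 2.
Context (A : set (H -> H)).
Context (vnA : von_neumann_algebra dot A) (nz : (idfun : H -> H) <> 0).
Local Notation B := (opalg vnA nz).
Implicit Types (a b x y : B) (f g : R -> B) (J : set R) (s t m : R).

Lemma cvg_opM T (F : set_system T) {FF : Filter F} (f g : T -> B) a b :
  f @ F --> a -> g @ F --> b -> f s * g s @[s --> F] --> a * b.
Proof.
move=> fa gb; apply/subr_cvg0/norm_cvg0P.
have fa0 : `|f s - a| @[s --> F] --> (0 : R) by apply/norm_cvg0P/subr_cvg0.
have gb0 : `|g s - b| @[s --> F] --> (0 : R) by apply/norm_cvg0P/subr_cvg0.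
have h : `|f s - a| * `|g s - b| + `|a| * `|g s - b| + `|f s - a| * `|b|
    @[s --> F] --> (0 : R).
  rewrite [X in _ --> X](_ : _ = 0 * 0 + `|a| * 0 + 0 * `|b|); last by ring.
  apply: cvgD; first apply: cvgD; apply: cvgM => //; exact: cvg_cst.
apply: squeeze_cvgr (cvg_cst 0) h; apply: nearW => s; rewrite normr_ge0/=.
have -> : f s * g s - a * b = (f s - a) * (g s - b) + a * (g s - b) + (f s - a) * b.
  by nc_ring.
rewrite (le_trans (ler_normD _ _))// lerD ?opalg_normM//.
by rewrite (le_trans (ler_normD _ _))// lerD ?opalg_normM.
Qed.

Lemma derivM J f g t x y : deriv J f t x -> deriv J g t y ->
  deriv J (fun s => f s * g s) t (x * g t + f t * y).
Proof.
move=> df dg; rewrite /deriv.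
rewrite (_ : (fun s => _) = fun s =>
  ((s - t)^-1 *: (f s - f t)) * g s + f t * ((s - t)^-1 *: (g s - g t))).
  apply: cvgD; first by apply: cvg_opM df _; exact: deriv_cvg dg.
  by apply: cvg_opM dg; exact: cvg_cst.
apply/funext => s; rewrite -scalerAl -scalerAr -scalerDr; congr (_ *: _).
by nc_ring.
Qed.

(** The identity [a (f^-1 - a^-1) = - (f - a) f^-1] bounds [|f^-1 - a^-1|] in
   terms of itself, with a factor that is small near the limit. *)
Lemma cvg_opV T (F : set_system T) {FF : Filter F} (f : T -> B) m a :
  0 < m -> gap m a -> (\forall s \near F, f s \is a GRing.unit) ->
  f @ F --> a -> (f s)^-1 @[s --> F] --> a^-1.
Proof.
move=> m0 ga uf fa; have ua := gap_unit m0 ga.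
apply/subr_cvg0/norm_cvg0P.
have fa0 : `|f s - a| @[s --> F] --> (0 : R) by apply/norm_cvg0P/subr_cvg0.
have h : 2 / m * `|a^-1| * `|f s - a| @[s --> F] --> (0 : R).
  rewrite [X in _ --> X](_ : _ = 2 / m * `|a^-1| * 0); last by rewrite mulr0.
  by apply: cvgM => //; exact: cvg_cst.
apply: squeeze_cvgr (cvg_cst 0) h; near=> s; rewrite normr_ge0/=.
have us : f s \is a GRing.unit by near: s.
have fs : `|f s - a| <= m / 2.
  by near: s; move/cvgrPdistC_le: fa; apply; rewrite divr_gt0.
set z := (f s)^-1 - a^-1.
have := lmul_lower_bound z ga.
have -> : a * z = - ((f s - a) * (f s)^-1).
  by rewrite mulrBr divrr// mulrBl divrr// opprB.
rewrite normrN => /le_trans/(_ (opalg_normM _ _)) h1.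
have h2 : `|(f s)^-1| <= `|z| + `|a^-1|.
  by rewrite -{1}[(f s)^-1](subrK a^-1) ler_normD.
have h3 := ler_wpM2l (normr_ge0 (f s - a)) h2.
have h4 := ler_wpM2r (normr_ge0 z) fs.
rewrite (_ : 2 / m * _ * _ = m^-1 * (2 * `|a^-1| * `|f s - a|)); last by ring.
rewrite ler_pdivlMl//; move: h1 h3 h4; lra.
Unshelve. all: by end_near. Qed.

Lemma derivV J f t x : J t -> (forall s, J s -> cone (f s)) -> deriv J f t x ->
  deriv J (fun s => (f s)^-1) t (- ((f t)^-1 * x * (f t)^-1)).
Proof.
move=> Jt cf df; have [m m0 ga] := cone_gap dot_norm (cf t Jt).
have ut := cone_unit (cf t Jt).
have uJ : \forall s \near within J t^', f s \is a GRing.unit.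
  by rewrite near_withinE; apply: nearW => s /cf/cone_unit.
have fV : (f s)^-1 @[s --> within J t^'] --> (f t)^-1.
  exact: cvg_opV m0 ga uJ (deriv_cvg df).
rewrite /deriv.
pose q s := - ((f s)^-1 * ((s - t)^-1 *: (f s - f t)) * (f t)^-1).
apply: (@cvg_trans _ (q @ within J t^')).
  apply: near_eq_cvg; near=> s.
  have us : f s \is a GRing.unit by near: s.
  rewrite /q -scalerAr -scalerAl -scalerN; congr (_ *: _).
  by rewrite mulrBr mulrBl mulVr// mul1r mulrK// opprB.
by rewrite /q; apply: cvgN; apply: cvg_opM (cvg_cst _); exact: cvg_opM fV df.
Unshelve. all: by end_near. Qed.

Lemma deriv_sa J f t x : ProperFilter (within J t^') ->
  (forall s, J s -> sa (f s)) -> J t -> deriv J f t x -> sa x.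
Proof.
move=> PF saf Jt df.
apply: (@closed_cvg _ _ _ PF _ [set b : B | sa b]) df => //.
  exact: closed_sa.
rewrite near_withinE; apply: nearW => s Js; apply: adjZ; apply: adjB; exact: saf.
Qed.

(** Subtracting the squares at [s] and [t] gives a Sylvester equation for the
   increment, and [sylvester_lower_bound] turns it into an estimate. *)
Lemma sqrt_lipschitz m a b : gap m a -> cone b ->
  m * `|b - a| <= `|b * b - a * a|.
Proof.
move=> ga /(cone_gap dot_norm)[n n0 gb].
have := sylvester_lower_bound (b - a) gb ga.
rewrite (_ : b * (b - a) + _ = b * b - a * a); last by nc_ring.
by apply: le_trans; rewrite ler_wpM2r// lerDr ltW.
Qed.

Lemma gap_near m n a b : gap m a -> `|b - a| <= n -> gap (m - n) b.
Proof.
move=> [c hc] ab; exists c; have := ler_distD a c%:A b.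
by rewrite [`|a - b|]distrC; move: hc ab; lra.
Qed.

Section SquareRootCurve.
Context (J : set R) (f r : R -> B).
Hypothesis rcone : forall s, J s -> cone (r s).
Hypothesis rE : forall s, J s -> r s * r s = f s.

Lemma sqrt_cvg (F : set_system R) {FF : Filter F} t : J t -> F J ->
  f s @[s --> F] --> f t -> r s @[s --> F] --> r t.
Proof.
move=> Jt FJ ft; have [m m0 ga] := cone_gap dot_norm (rcone Jt).
apply/subr_cvg0/norm_cvg0P.
have h : m^-1 * `|f s - f t| @[s --> F] --> (0 : R).
  rewrite [X in _ --> X](_ : _ = m^-1 * 0); last by rewrite mulr0.
  apply: cvgM; first exact: cvg_cst.
  by apply/norm_cvg0P/subr_cvg0.
apply: squeeze_cvgr (cvg_cst 0) h; apply: filterS FJ => s Js.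
rewrite normr_ge0/= ler_pdivlMl//.
by rewrite -(rE Js) -(rE Jt) sqrt_lipschitz//; exact: rcone.
Qed.

Lemma deriv_sqrt t x y : J t -> deriv J f t y -> r t * x + x * r t = y ->
  deriv J r t x.
Proof.
move=> Jt df xE; have [m m0 ga] := cone_gap dot_norm (rcone Jt).
have FJ : within J t^' J by exact: withinT.
have r0 : `|r s - r t| @[s --> within J t^'] --> (0 : R).
  by apply/norm_cvg0P/subr_cvg0; apply: sqrt_cvg => //; exact: deriv_cvg df.
apply/subr_cvg0/norm_cvg0P.
pose q s := (s - t)^-1 *: (f s - f t).
have q0 : `|q s - y| @[s --> within J t^'] --> (0 : R) by apply/norm_cvg0P/subr_cvg0.
have h : (2 * m)^-1 * (`|q s - y| + (m^-1 * `|q s|) * `|r s - r t|)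
    @[s --> within J t^'] --> (0 : R).
  rewrite [X in _ --> X](_ : _ = (2 * m)^-1 * (0 + (m^-1 * `|y|) * 0)); last by ring.
  apply: cvgM; first exact: cvg_cst.
  apply: cvgD => //; apply: cvgM => //; apply: cvgM; first exact: cvg_cst.
  exact: cvg_norm.
apply: squeeze_cvgr (cvg_cst 0) h; rewrite near_withinE; apply: nearW => s Js.
rewrite normr_ge0/=; set p := (s - t)^-1 *: (r s - r t).
have qE : r t * p + p * r t = q s - p * (r s - r t).
  rewrite /p /q -(rE Js) -(rE Jt) -!scalerAl -scalerAr -scalerDr -scalerBr.
  by congr (_ *: _); nc_ring.
have p_le : `|p| <= m^-1 * `|q s|.
  rewrite ler_pdivlMl// /p /q !normrZ mulrCA ler_wpM2l//.
  by rewrite -(rE Js) -(rE Jt) sqrt_lipschitz//; exact: rcone.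
have := sylvester_lower_bound (p - x) ga ga.
rewrite (_ : _ * (p - x) + _ = (q s - y) - p * (r s - r t)); last first.
  have -> : q s - y - p * (r s - r t) = (q s - p * (r s - r t)) - y by nc_ring.
  by rewrite -qE -xE; nc_ring.
rewrite (_ : m + m = 2 * m); last by ring.
rewrite ler_pdivlMl ?mulr_gt0//.
move=> /le_trans; apply; rewrite (le_trans (ler_normB _ _))// lerD//.
by rewrite (le_trans (opalg_normM _ _))// ler_wpM2r.
Qed.

(** The difference of two solutions solves a Sylvester equation with coefficient
   [r s], whose lower bound is uniform for [s] near [t]. *)
Lemma sqrt_deriv_cont (y x : R -> B) t : J t ->
  f s @[s --> within J (nbhs t)] --> f t ->
  y s @[s --> within J (nbhs t)] --> y t ->
  (forall s, J s -> r s * x s + x s * r s = y s) ->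
  x s @[s --> within J (nbhs t)] --> x t.
Proof.
move=> Jt ft yt xE; have [m m0 ga] := cone_gap dot_norm (rcone Jt).
have FJ : within J (nbhs t) J by exact: withinT.
have m2 : 0 < m / 2 by rewrite divr_gt0.
have rt : r s @[s --> within J (nbhs t)] --> r t by exact: sqrt_cvg.
have r0 : `|r s - r t| @[s --> within J (nbhs t)] --> (0 : R).
  by apply/norm_cvg0P/subr_cvg0.
apply/subr_cvg0/norm_cvg0P.
have y0 : `|y s - y t| @[s --> within J (nbhs t)] --> (0 : R).
  by apply/norm_cvg0P/subr_cvg0.
have h : m^-1 * (`|y s - y t| + 2 * `|x t| * `|r s - r t|)
    @[s --> within J (nbhs t)] --> (0 : R).
  rewrite [X in _ --> X](_ : _ = m^-1 * (0 + 2 * `|x t| * 0)); last by ring.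
  apply: cvgM; first exact: cvg_cst.
  by apply: cvgD => //; apply: cvgM => //; exact: cvg_cst.
apply: squeeze_cvgr (cvg_cst 0) h; rewrite near_withinE.
near=> s => Js; rewrite normr_ge0/= ler_pdivlMl//.
have gs : gap (m - m / 2) (r s).
  apply: gap_near ga _; move: Js; near: s; rewrite -near_withinE.
  by move/cvgrPdistC_le: rt; apply.
have := sylvester_lower_bound (x s - x t) gs gs.
rewrite (_ : m - m / 2 + (m - m / 2) = m); last by field.
move=> /le_trans; apply.
have -> : r s * (x s - x t) + (x s - x t) * r s =
    (y s - y t) - ((r s - r t) * x t + x t * (r s - r t)).
  by rewrite -(xE s Js) -(xE t Jt); nc_ring.
rewrite (le_trans (ler_normB _ _))// lerD//.
rewrite (le_trans (ler_normD _ _))// mulr_natl mulr2n [leRHS]mulrDl.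
rewrite lerD// (le_trans (opalg_normM _ _))//.
by rewrite mulrC.
Unshelve. all: by end_near. Qed.

End SquareRootCurve.
End Calculus.

(** * The trace and the metric *)

Section Trace.
Context (R : realType) (H : completeNormedModType R[i]).
Context (dot : {dot H for Num.conj}).
Hypothesis dot_norm : forall x : H, dot x x = `|x| ^+ 2.
Context (A : set (H -> H)).
Context (vnA : von_neumann_algebra dot A) (nz : (idfun : H -> H) <> 0).
Context (tau : (H -> H) -> R[i]).
Hypotheses (tau_state : is_state dot A tau) (tau_tracial : is_tracial A tau).
Local Notation B := (opalg vnA nz).
Implicit Types (a b c e f g h k p s w x y z : B) (r : R).

Definition tr a : R := complex.Re (tau (opval a)).

Lemma tau_lin (c : R[i]) (S T : H -> H) : A S -> A T ->
  tau (c *: S + T) = c * tau S + tau T.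
Proof. by case: tau_state => + _ _; exact. Qed.

Lemma tau0 : tau 0 = 0.
Proof.
have := tau_lin 1 (vn_zero vnA) (vn_zero vnA).
by rewrite scale1r addr0 mul1r => /eqP; rewrite -subr_eq subrr eq_sym => /eqP.
Qed.

Lemma tau_scale (c : R[i]) (T : H -> H) : A T -> tau (c *: T) = c * tau T.
Proof. by move=> AT; have := tau_lin c AT (vn_zero vnA); rewrite tau0 !addr0. Qed.

Lemma trD a b : tr (a + b) = tr a + tr b.
Proof.
have := tau_lin 1 (opvalP a) (opvalP b).
by rewrite /tr scale1r mul1r -raddfD => <-.
Qed.

Lemma trZ r a : tr (r *: a) = r * tr a.
Proof.
rewrite /tr -[opval (r *: a)]/(r%:C *: opval a) (tau_scale _ (opvalP a)).
by case: (tau _) => u v /=; rewrite mul0r subr0.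
Qed.

Lemma trN a : tr (- a) = - tr a.
Proof. by rewrite -scaleN1r trZ mulN1r. Qed.

Lemma trB a b : tr (a - b) = tr a - tr b.
Proof. by rewrite trD trN. Qed.

Lemma tr_comm a b : tr (a * b) = tr (b * a).
Proof. exact: congr1 (tau_tracial (opvalP a) (opvalP b)). Qed.

Lemma tau_pos a : pos a -> 0 <= tau (opval a).
Proof. by case: tau_state => _ + _; apply; exact: opvalP. Qed.

Lemma tr_adj_ge0 a b : adj a b -> 0 <= tr (a * b).
Proof.
move=> ab; have /tau_pos : pos (a * b).
  apply/posP; split; first by apply: adjM => //; exact: adj_sym.
  move=> x; rewrite opvalM; move/adjP: ab => ->.
  by rewrite rdotxx// exprn_ge0// rnorm_ge0.
by rewrite lecE => /andP[].
Qed.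

Lemma tr_sqr_ge0 a : sa a -> 0 <= tr (a * a). Proof. exact: tr_adj_ge0. Qed.

(** [|a| + a] is positive when [a] is self-adjoint. *)
Lemma tau_sa a : sa a -> complex.Im (tau (opval a)) = 0 /\ - `|a| <= tr a.
Proof.
move=> saa; have /tau_pos : pos (`|a|%:A + a).
  apply/posP; split; first by apply: adjD => //; apply: adjZ; exact: adj1.
  move=> x; rewrite opvalD opvalZ opval1 rdotDl rdotZl rdotxx//.
  have := rdot_abs_le dot_norm (opval a x) x; rewrite ler_norml => /andP[+ _].
  have := ler_wpM2r (rnorm_ge0 x) (opval_norm_le a x); rewrite expr2; lra.
have [_ _ tau1] := tau_state.
have -> : tau (opval (`|a|%:A + a)) = `|a|%:C + tau (opval a).
  rewrite -[opval _]/(`|a|%:C *: idfun + opval a) (tau_lin _ (vn_id vnA) (opvalP a)).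
  by rewrite tau1 mulr1.
rewrite /tr; case: (tau (opval a)) => u v; rewrite lecE /= add0r => /andP[/eqP -> h].
by split=> //; rewrite -subr_ge0 opprK addrC.
Qed.

Lemma tr_sa_le a : sa a -> `|tr a| <= `|a|.
Proof.
move=> saa; rewrite ler_norml (tau_sa saa).2/=.
by have := (tau_sa (adjN saa)).2; rewrite normrN trN lerN2.
Qed.

(** [i (a - b)] is self-adjoint, so its trace is real. *)
Lemma tr_adj a b : adj a b -> tr a = tr b.
Proof.
move=> ab; pose y : B := Opalg vnA nz (vn_scale vnA 'i (opvalP (a - b))).
have yE (u : H) : opval y u = 'i *: opval (a - b) u by [].
have hi (u v : H) : rdot dot ('i *: u) v = - rdot dot u ('i *: v).
  rewrite -[RHS]rdotNr -[in RHS](rdot_i dot u) -scalerN scalerA -expr2 sqr_i.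
  by rewrite scaleN1r opprK.
have [im _] : complex.Im (tau (opval y)) = 0 /\ - `|y| <= tr y.
  apply: tau_sa; apply/adjP => u v; rewrite !yE hi.
  have := adjB ab (adj_sym ab) => /adjP ->; rewrite -rdotNr -opvalN opprB.
  by rewrite bounded_opZ.
move: im; rewrite -[opval y]/('i *: opval (a - b)) (tau_scale _ (opvalP (a - b))).
rewrite mulrC ImiRe -/(tr _) trB => /eqP; rewrite subr_eq0 => /eqP ab'.
exact: ab'.
Qed.

Lemma adj_norm_le a b : adj a b -> `|b| <= `|a|.
Proof.
move=> /adjP ab; apply: opalg_norm_le => // x.
have [->|/rnorm_gt0 bx0] := eqVneq (opval b x) 0.
  by rewrite rnorm0 mulr_ge0// rnorm_ge0.
rewrite -(ler_pM2r bx0) -expr2 -(rdotxx dot_norm) -ab.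
rewrite (le_trans (rdot_le dot_norm _ _))// mulrAC ler_wpM2r ?rnorm_ge0//.
exact: opval_norm_le.
Qed.

Lemma tr_le a : `|tr a| <= `|a|.
Proof.
have [b ab] := adj_ex a.
have h : tr (a + b) = 2 * tr a by rewrite trD -(tr_adj ab); ring.
have sab : sa (a + b) by rewrite /sa {2}[a + b]addrC; apply: adjD => //; exact: adj_sym.
have := tr_sa_le sab; rewrite h normrM ger0_norm//.
have := ler_normD a b; have := adj_norm_le ab; lra.
Qed.

Lemma cvg_tr T (F : set_system T) {FF : Filter F} (u : T -> B) a :
  u @ F --> a -> tr (u t) @[t --> F] --> tr a.
Proof.
move=> ua; apply/subr_cvg0/norm_cvg0P.
have h : `|u t - a| @[t --> F] --> (0 : R) by apply/norm_cvg0P/subr_cvg0.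
apply: squeeze_cvgr (cvg_cst 0) h; apply: nearW => t.
by rewrite normr_ge0/= -trB tr_le.
Qed.

(** The Hilbert-Schmidt norm of the trace, on self-adjoint elements. *)
Definition hs x := Num.sqrt (tr (x * x)).

Lemma hs_ge0 x : 0 <= hs x. Proof. exact: sqrtr_ge0. Qed.

Lemma hs_sqr x : sa x -> hs x ^+ 2 = tr (x * x).
Proof. by move=> sx; rewrite sqr_sqrtr// tr_sqr_ge0. Qed.

(** Comparing with [hs + r] instead of [hs] avoids division by zero. *)
Lemma tr_cauchy_schwarz x y r : sa x -> sa y -> 0 < r ->
  tr (x * y) <= (hs x + r) * (hs y + r).
Proof.
move=> sx sy r0; set l := hs x + r; set m := hs y + r.
have l0 : 0 < l by rewrite ltr_wpDl ?hs_ge0.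
have m0 : 0 < m by rewrite ltr_wpDl ?hs_ge0.
have := tr_sqr_ge0 (adjB (adjZ m sx) (adjZ l sy)).
rewrite mulrBl !mulrBr -!scalerAl -!scalerAr !trB !trZ (tr_comm y x).
have hx : tr (x * x) <= l ^+ 2.
  by rewrite -hs_sqr// ler_sqr ?nnegrE ?hs_ge0// ?(ltW l0)// lerDl ltW.
have hy : tr (y * y) <= m ^+ 2.
  by rewrite -hs_sqr// ler_sqr ?nnegrE ?hs_ge0// ?(ltW m0)// lerDl ltW.
have {}hx := ler_wpM2l (ltW (exprn_gt0 2 m0)) hx.
have {}hy := ler_wpM2l (ltW (exprn_gt0 2 l0)) hy.
move=> h; have : 2 * (m * l) * tr (x * y) <= 2 * (m * l) * (l * m).
  by move: hx hy h; rewrite !expr2; lra.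
by rewrite ler_pM2l// mulr_gt0// mulr_gt0.
Qed.

Lemma hs_triangle x y : sa x -> sa y -> hs (x + y) <= hs x + hs y.
Proof.
move=> sx sy; apply/ler_addgt0Pr => e e0.
have r0 : 0 < e / 2 by rewrite divr_gt0.
have pos_rhs : 0 <= hs x + hs y + e by rewrite !addr_ge0 ?hs_ge0// ltW.
rewrite -(ler_pXn2r (_ : (0 < 2)%N)) ?nnegrE ?hs_ge0//.
rewrite hs_sqr; last exact: adjD.
rewrite mulrDl !mulrDr !trD (tr_comm y x) -!hs_sqr//.
have := tr_cauchy_schwarz sx sy r0.
have := hs_ge0 x; have := hs_ge0 y.
have := mulr_ge0 (ltW e0) (hs_ge0 x); have := mulr_ge0 (ltW e0) (hs_ge0 y).
have := mulr_ge0 (ltW e0) (ltW e0).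
rewrite !expr2; lra.
Qed.

Definition speed a x := Num.sqrt (tr (x * a^-1 * x * a^-1)).

Lemma speed_metric a x : cone a -> speed a x = metric_norm tau (opval a) (opval x).
Proof. by move=> ca; rewrite /metric_norm /metric (cone_op_inv ca). Qed.

(** Congruences [x |-> g x g] are isometries of the metric. *)
Lemma speed_congr g c x : g \is a GRing.unit -> c \is a GRing.unit ->
  speed (g * c * g) (g * x * g) = speed c x.
Proof.
move=> ug uc; congr Num.sqrt.
have ucg : g * c \is a GRing.unit by rewrite unitrMl.
have E : g * x * g * (g * c * g)^-1 = g * (x * c^-1) * g^-1.
  by rewrite !invrM// !mulrA mulrK.
rewrite -mulrA !E.
have -> : g * (x * c^-1) * g^-1 * (g * (x * c^-1) * g^-1) =
    g * (x * c^-1 * x * c^-1) * g^-1 by rewrite !mulrA mulrVK.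
by rewrite tr_comm mulrA mulVr// mul1r.
Qed.

Lemma speed_hs c s x : s * s = c -> s \is a GRing.unit ->
  speed c x = hs (s^-1 * x * s^-1).
Proof.
by move=> <- us; congr Num.sqrt; rewrite invrM// !mulrA tr_comm !mulrA.
Qed.

(** The differential of the geometric mean [g s g] of [g^2] and [g s^2 g], after
   conjugation by [g]: [h] and [k] stand for [g^-1 g'] and [g' g^-1], [d] for
   [s'].  The velocities [e], [f] and [w] of the two endpoints and of the mean
   satisfy [w s + s w = f + s e s], which bounds the Hilbert-Schmidt norm of
   [s^-1 w + w s^-1] by the two given speeds.  Its square is at least
   [4 tr (w s^-1 w s^-1)] because the commutator [v] of [s^-1] and [w] satisfies
   [0 <= - tr (v v)]; this is the Corach-Porta-Recht inequality for
   [q = s^(1/2)] and [x = q^-1 w q^-1]. *)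
Lemma geometric_mean_speed s h k d : let e := h + k in
  let f := h * s * s + (d * s + s * d) + s * s * k in
  let w := h * s + d + s * k in
  cone s -> sa e -> sa f -> sa w ->
  speed s w <= 2^-1 * (hs e + speed (s * s) f).
Proof.
move=> e f w cs se sf sw; have us := cone_unit cs.
have wE : w * s + s * w = f + s * e * s by rewrite /w /f /e; nc_ring.
clearbody e f w.
set p := s^-1; have sp : sa p by exact: saV (cone_sa cs).
have ps : p * s = 1 by exact: mulVr.
have sp1 : s * p = 1 by exact: divrr.
have E : p * w + w * p = p * f * p + e.
  have -> : p * w + w * p = p * (w * s + s * w) * p.
    rewrite mulrDr mulrDl -!mulrA sp1 mulr1 [p * (s * _)]mulrA ps mul1r.
    by [].
  rewrite wE mulrDr mulrDl; congr (_ + _).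
  by rewrite -!mulrA sp1 mulr1 mulrA ps mul1r.
rewrite (speed_hs f (erefl (s * s)) us) -/p ler_pdivlMl// addrC.
apply: le_trans (hs_triangle (sa_congr sp sf) se); rewrite -E.
rewrite /speed -/p -{1}[2]ger0_norm// -sqrtr_sqr -sqrtrM ?sqr_ge0//.
apply: ler_wsqrtr.
have : adj (p * w - w * p) (w * p - p * w) by apply: adjB; exact: adjM.
move=> /tr_adj_ge0.
rewrite mulrBl !mulrBr mulrDl !mulrDr !trB !trD.
have c1 : tr (p * w * (p * w)) = tr (w * p * w * p) by rewrite !mulrA tr_comm !mulrA.
have c2 : tr (w * p * (w * p)) = tr (w * p * w * p) by rewrite !mulrA.
have c3 : tr (w * p * (p * w)) = tr (p * w * (w * p)) by rewrite tr_comm.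
by rewrite c1 c2 c3; lra.
Qed.

End Trace.

(** * Geodesics and the geometric mean of two curves *)

Section Curves.
Context (R : realType) (H : completeNormedModType R[i]).
Context (dot : {dot H for Num.conj}).
Hypothesis dot_norm : forall x : H, dot x x = `|x| ^+ 2.
Context (A : set (H -> H)).
Context (vnA : von_neumann_algebra dot A) (nz : (idfun : H -> H) <> 0).
Local Notation B := (opalg vnA nz).
Implicit Types (a b x y : B) (f g df dg : R -> B) (J : set R) (s t m u : R).

(** Total, because a curve of operators is a function into [H -> H] that stays in
   [A] only on its interval. *)
Definition to_opalg (T : H -> H) : B :=
  if pselect (A T) is left AT then Opalg vnA nz AT else 0.

Lemma to_opalgK T : A T -> opval (to_opalg T) = T.
Proof. by rewrite /to_opalg; case: pselect. Qed.

Lemma to_opalg_cone T : positive_cone dot A T -> cone (to_opalg T).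
Proof. by move=> cT; rewrite /cone to_opalgK//; case: cT. Qed.

Lemma op_derivP J (g : R -> H -> H) t v : J t -> (forall s, J s -> A (g s)) ->
  op_deriv A J g t v -> deriv J (to_opalg \o g) t (to_opalg v).
Proof.
move=> Jt Ag [Av h]; apply/subr_cvg0/norm_cvg0P.
apply: cvg_trans h; apply: near_eq_cvg; rewrite near_withinE.
apply: nearW => s Js; rewrite opalg_normE; congr opnorm.
apply/funext => x; rewrite opvalB opvalZ opvalB /=.
by rewrite !to_opalgK//; exact: Ag.
Qed.

Lemma deriv_op_deriv J f t x : deriv J f t x ->
  op_deriv A J (fun s => opval (f s)) t (opval x).
Proof.
move=> h; split; first exact: opvalP.
have : `|(s - t)^-1 *: (f s - f t) - x| @[s --> within J t^'] --> (0 : R).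
  by apply/norm_cvg0P/subr_cvg0.
exact.
Qed.

Lemma op_continuousP J (g : R -> H -> H) : (forall s, J s -> A (g s)) ->
  op_continuous_on J g -> forall t, J t ->
  to_opalg (g s) @[s --> within J (nbhs t)] --> to_opalg (g t).
Proof.
move=> Ag cg t Jt; apply/subr_cvg0/norm_cvg0P.
apply: cvg_trans (cg t Jt); apply: near_eq_cvg; rewrite near_withinE.
apply: nearW => s Js; rewrite opalg_normE; congr opnorm.
by apply/funext => x; rewrite opvalB /= !to_opalgK//; exact: Ag.
Qed.

Lemma continuous_op_continuous J f :
  (forall t, J t -> f s @[s --> within J (nbhs t)] --> f t) ->
  op_continuous_on J (fun s => opval (f s)).
Proof.
move=> cf t Jt.
have : `|f s - f t| @[s --> within J (nbhs t)] --> (0 : R).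
  by apply/norm_cvg0P/subr_cvg0; exact: cf.
exact.
Qed.

(** [gamma^-1 gamma'] and [gamma' gamma^-1] are constant along a geodesic, so
   [gamma (m + h) gamma(m)^-1 gamma (m - h)] does not depend on [h]. *)
Lemma geodesic_midpoint J (gamma : R -> H -> H) (a b : R) :
  is_interval J -> geodesic_on dot A J gamma -> J a -> J b -> a < b ->
  let G t := to_opalg (gamma t) in
  G ((a + b) / 2) * (G a)^-1 * G ((a + b) / 2) = G b.
Proof.
move=> iJ [g1 [g2 geo]] Ja Jb ab G.
have abJ : `[a, b]%classic `<=` J.
  by move=> t; rewrite /= in_itv/= => tab; exact: iJ Ja Jb _ tab.
pose G1 t := to_opalg (g1 t); pose G2 t := to_opalg (g2 t).
pose I := `[a, b]%classic.
have cG t : I t -> cone (G t).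
  by move=> /abJ/geo[cg _ _ _]; exact: to_opalg_cone.
have uG t : I t -> G t \is a GRing.unit by move=> /cG/cone_unit.
have dG t : I t -> deriv I G t (G1 t).
  move=> /abJ Jt; apply: deriv_sub abJ _; have [_ h _ _] := geo t Jt.
  by apply: op_derivP h => // s /geo[[]].
have dG1 t : I t -> deriv I G1 t (G2 t).
  move=> /abJ Jt; apply: deriv_sub abJ _; have [_ _ h _] := geo t Jt.
  by apply: op_derivP h => // s /geo[_ []].
have G2E t : I t -> G2 t = G1 t * (G t)^-1 * G1 t.
  move=> It; have Jt := abJ _ It; have [cg [A1 _] [A2 _] e] := geo t Jt.
  apply: opval_inj; rewrite to_opalgK// e.
  have -> : op_inv (gamma t) = opval (G t)^-1.
    by rewrite -(cone_op_inv (cG t It)) to_opalgK//; case: cg.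
  by apply/funext => x; rewrite !opvalM !to_opalgK.
have dGV t : I t -> deriv I (fun s => (G s)^-1) t (- ((G t)^-1 * G1 t * (G t)^-1)).
  by move=> It; apply: derivV => //; exact: dG.
have Ia : I a by rewrite /I/= in_itv/= lexx ltW.
have sub t : I t -> `[a, t]%classic `<=` I.
  rewrite /I/= => /[!in_itv]/= /andP[_ tb] s; rewrite /= !in_itv/= => /andP[-> st].
  exact: le_trans tb.
have at_ t : I t -> a <= t by rewrite /I/= in_itv/= => /andP[].
have cst1 t : I t -> (G t)^-1 * G1 t = (G a)^-1 * G1 a.
  move=> It; apply: (deriv0_const (f := fun s => (G s)^-1 * G1 s) (at_ t It)).
  move=> s /(sub _ It) Is.
  have := derivM (dGV s Is) (dG1 s Is).
  rewrite G2E// (_ : _ + _ = 0); last by nc_ring.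
  exact: deriv_sub (sub _ It).
have cst2 t : I t -> G1 t * (G t)^-1 = G1 a * (G a)^-1.
  move=> It; apply: (deriv0_const (f := fun s => G1 s * (G s)^-1) (at_ t It)).
  move=> s /(sub _ It) Is.
  have := derivM (dG1 s Is) (dGV s Is).
  rewrite G2E// (_ : _ + _ = 0); last by nc_ring.
  exact: deriv_sub (sub _ It).
pose m := (a + b) / 2; rewrite -/m.
have mE : a + b - m = m by rewrite /m; field.
have Im : I m by rewrite /I/= in_itv/= /m; apply/andP; split; lra.
have Ib : I b by rewrite /I/= in_itv/= lexx ltW.
have Ir t : I t -> I (a + b - t).
  by rewrite /I/= !in_itv/= => /andP[h1 h2]; apply/andP; split; lra.
have mb : m <= b by move: Im; rewrite /I/= in_itv/= => /andP[].
have subm : `[m, b]%classic `<=` I.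
  move=> s; rewrite /I/= !in_itv/= => /andP[ms ->]; rewrite andbT.
  exact: le_trans (at_ m Im) ms.
have : G b * (G m)^-1 * G (a + b - b) = G m * (G m)^-1 * G (a + b - m).
  apply: (deriv0_const (f := fun u => G u * (G m)^-1 * G (a + b - u)) mb).
  move=> t /subm It; apply: (deriv_sub subm).
  have := derivM (derivM (dG t It) (@deriv_cst _ _ I (G m)^-1 t))
    (deriv_reflect (dG _ (Ir t It))).
  set v := (X in deriv _ _ _ X); suff -> : v = 0 by [].
  rewrite /v mulr0 addr0.
  have -> : G1 t = G t * ((G m)^-1 * G1 m) by rewrite cst1// -(cst1 t It) mulVKr// uG.
  have -> : G1 (a + b - t) = (G1 m * (G m)^-1) * G (a + b - t).
    by rewrite cst2// -(cst2 _ (Ir t It)) mulrVK//; exact/uG/Ir.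
  nc_ring.
rewrite mE divrr ?uG// mul1r addrK => e.
by rewrite -{1}e mulrK ?uG// mulrVK ?uG.
Qed.

End Curves.

Section MeanCurve.
Context (R : realType) (H : completeNormedModType R[i]).
Context (dot : {dot H for Num.conj}).
Hypothesis dot_norm : forall x : H, dot x x = `|x| ^+ 2.
Context (A : set (H -> H)).
Context (vnA : von_neumann_algebra dot A) (nz : (idfun : H -> H) <> 0).
Context (tau : (H -> H) -> R[i]).
Hypotheses (tau_state : is_state dot A tau) (tau_tracial : is_tracial A tau).
Local Notation B := (opalg vnA nz).
Local Notation I := (`[0, 1]%classic : set R).
Implicit Types (a b x y : B) (f g df dg : R -> B) (s t m u : R).

(** The counterpart of [smooth_curve] for curves in the Banach algebra. *)
Definition cone_curve f df := [/\ forall t, I t -> cone (f t),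
  forall t, I t -> deriv I f t (df t) &
  forall t, I t -> df s @[s --> within I (nbhs t)] --> df t].

Definition op_sqrt a : B := xget 0 [set s | cone s /\ s * s = a].

Lemma op_sqrtP a : cone a -> cone (op_sqrt a) /\ op_sqrt a * op_sqrt a = a.
Proof.
move=> ca; have [s hs] := cone_sqrt dot_norm ca.
by rewrite /op_sqrt; case: xgetP => // /(_ s).
Qed.

Definition sylvester a y : B := xget 0 [set x | a * x + x * a = y].

Lemma sylvesterP a y : cone a -> a * sylvester a y + sylvester a y * a = y.
Proof.
move=> /(cone_gap dot_norm)[m m0 ga]; have [x hx] := sylvester_solution y m0 ga.
by rewrite /sylvester; case: xgetP => // /(_ x).
Qed.

Lemma cone_curve_cont f df t : cone_curve f df -> I t ->
  f s @[s --> within I (nbhs t)] --> f t.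
Proof. by move=> [_ df' _] It; exact: deriv_cont (df' t It). Qed.

Lemma cone_curve_sqrt f df : cone_curve f df ->
  cone_curve (fun t => op_sqrt (f t)) (fun t => sylvester (op_sqrt (f t)) (df t)).
Proof.
move=> cf; have [fcone fd fc] := cf.
have rc t : I t -> cone (op_sqrt (f t)) by move=> /fcone/op_sqrtP[].
have rE t : I t -> op_sqrt (f t) * op_sqrt (f t) = f t by move=> /fcone/op_sqrtP[].
split=> // t It.
  by apply: (deriv_sqrt dot_norm rc rE It (fd t It)); exact/sylvesterP/rc.
apply: (sqrt_deriv_cont dot_norm rc rE It _ (fc t It)).
  exact: cone_curve_cont cf It.
by move=> s Is; exact/sylvesterP/rc.
Qed.

Lemma cone_curve_inv_cont f df t : cone_curve f df -> I t ->
  (f s)^-1 @[s --> within I (nbhs t)] --> (f t)^-1.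
Proof.
move=> cf It; have [fcone _ _] := cf.
have [m m0 ga] := cone_gap dot_norm (fcone t It).
apply: (cvg_opV m0 ga _ (cone_curve_cont cf It)).
by rewrite near_withinE; apply: nearW => s /fcone/cone_unit.
Qed.

Lemma within_unit_proper t : I t -> ProperFilter (within I t^').
Proof.
rewrite /= in_itv/= => /andP[t0 t1]; apply: Build_ProperFilter => h.
have : nbhs t [set x | x != t -> I x -> False] by exact: h.
move=> /nbhs_ballP[r /= r0 hr].
have [t2|t2] := leP t (1 / 2).
- pose s := Num.min (t + r / 2) 1.
  have ts : t < s by rewrite lt_min; apply/andP; split; lra.
  have sr : s <= t + r / 2 by rewrite ge_min lexx.
  apply: (hr s); rewrite ?gt_eqF//.
    by rewrite /ball/= ltr0_norm ?subr_lt0// opprB; lra.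
  by rewrite /= in_itv/= ge_min lexx orbT andbT; lra.
- pose s := Num.max (t - r / 2) 0.
  have ts : s < t by rewrite gt_max; apply/andP; split; lra.
  have sr : t - r / 2 <= s by rewrite le_max lexx.
  apply: (hr s); rewrite ?lt_eqF//.
    by rewrite /ball/= gtr0_norm ?subr_gt0//; lra.
  by rewrite /= in_itv/= le_max lexx orbT/=; lra.
Qed.

Lemma cone_curve_sa f df t : cone_curve f df -> I t -> sa (df t).
Proof.
move=> [fcone fd _] It; have PF := within_unit_proper It.
by apply: (deriv_sa dot_norm PF _ It (fd t It)) => s /fcone/cone_sa.
Qed.

(** The geometric mean [g s g], with [g = sqrt a] and [s = sqrt (g^-1 b g^-1)],
   is the positive solution of [x a^-1 x = b]. *)
Lemma cone_curve_mean (a da b db : R -> B) : cone_curve a da -> cone_curve b db ->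
  exists c dc, [/\ cone_curve c dc,
    forall t, I t -> c t * (a t)^-1 * c t = b t &
    forall t, I t -> speed tau (c t) (dc t) <=
      2^-1 * (speed tau (a t) (da t) + speed tau (b t) (db t))].
Proof.
move=> ca cb.
pose g t := op_sqrt (a t); pose dg t := sylvester (g t) (da t).
have cg : cone_curve g dg by exact: cone_curve_sqrt.
have gE t : I t -> g t * g t = a t by case: ca => + _ _ It => /(_ t It)/op_sqrtP[].
have gc t : I t -> cone (g t) by case: cg => + _ _ It; exact.
have gu t : I t -> g t \is a GRing.unit by move=> /gc/cone_unit.
have dgE t : I t -> g t * dg t + dg t * g t = da t by move=> /gc/sylvesterP; exact.
pose v t := (g t)^-1; pose dv t := - (v t * dg t * v t).
have vd t : I t -> deriv I v t (dv t).
  by move=> It; apply: derivV => //; case: cg => _ + _; exact.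
have vc t : I t -> v s @[s --> within I (nbhs t)] --> v t.
  exact: cone_curve_inv_cont cg.
have dvc t : I t -> dv s @[s --> within I (nbhs t)] --> dv t.
  move=> It; apply: cvgN; apply: cvg_opM; last exact: vc.
  by apply: cvg_opM; [exact: vc|case: cg => _ _; exact].
pose n t := v t * b t * v t.
pose dn t := (dv t * b t + v t * db t) * v t + v t * b t * dv t.
have cn : cone_curve n dn.
  split=> t It.
  - apply: cone_congr; rewrite ?unitrV ?gu//; last by case: cb => + _ _; exact.
    by apply: saV; [exact: gu|exact/cone_sa/gc].
  - apply: derivM; last exact: vd.
    by apply: derivM; [exact: vd|case: cb => _ + _; exact].
  have bc := cone_curve_cont cb It.
  have dbc : db s @[s --> within I (nbhs t)] --> db t by case: cb => _ _; exact.
  apply: cvgD.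
    apply: cvg_opM (vc t It); apply: cvgD.
      exact: cvg_opM (dvc t It) bc.
    exact: cvg_opM (vc t It) dbc.
  exact: cvg_opM (cvg_opM (vc t It) bc) (dvc t It).
pose s t := op_sqrt (n t); pose ds t := sylvester (s t) (dn t).
have cs : cone_curve s ds by exact: cone_curve_sqrt.
have sE t : I t -> s t * s t = n t by case: cn => + _ _ It => /(_ t It)/op_sqrtP[].
have sc t : I t -> cone (s t) by case: cs => + _ _ It; exact.
have dsE t : I t -> s t * ds t + ds t * s t = dn t by move=> /sc/sylvesterP; exact.
pose c t := g t * s t * g t.
pose dc t := (dg t * s t + g t * ds t) * g t + g t * s t * dg t.
have cc : cone_curve c dc.
  split=> t It.
  - by apply: cone_congr; [exact/cone_sa/gc|exact: gu|exact: sc].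
  - have [_ gd _] := cg; have [_ sd _] := cs.
    by apply: derivM; [apply: derivM; [exact: gd|exact: sd]|exact: gd].
  have gcv := cone_curve_cont cg It; have scv := cone_curve_cont cs It.
  have dgc : dg u @[u --> within I (nbhs t)] --> dg t by case: cg => _ _; exact.
  have dsc : ds u @[u --> within I (nbhs t)] --> ds t by case: cs => _ _; exact.
  apply: cvgD; last exact: cvg_opM (cvg_opM gcv scv) dgc.
  apply: (cvg_opM _ gcv); apply: cvgD; first exact: cvg_opM dgc scv.
  exact: cvg_opM gcv dsc.
have bE t : I t -> g t * (s t * s t) * g t = b t.
  move=> It; rewrite sE// /n /v !mulrA divrr ?gu// mul1r mulrVK ?gu//.
exists c, dc; split=> // t It.
  rewrite -gE// -bE// /c invrM ?gu// !mulrA mulrK ?gu// mulrVK ?gu//.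
have ug := gu t It; have us := cone_unit (sc t It).
pose h := v t * dg t; pose k := dg t * v t.
pose e := h + k; pose f := h * s t * s t + (ds t * s t + s t * ds t) + s t * s t * k.
pose w := h * s t + ds t + s t * k.
have daE : da t = g t * e * g t.
  rewrite -dgE// /e /h /k /v mulrDr mulrDl !mulrA divrr// mul1r mulrVK//.
  by rewrite addrC.
have dcE : dc t = g t * w * g t.
  rewrite /dc /w /h /k /v !mulrDr !mulrDl !mulrA divrr// mul1r mulrVK//.
have dbE : db t = g t * f * g t.
  have -> : f = v t * db t * v t.
    rewrite /f [ds t * _ + _]addrC dsE// /dn sE// -[h * s t * s t]mulrA sE//.
    rewrite /n /dv /h /k.
    by nc_ring.
  by rewrite /v !mulrA divrr// mul1r mulrVK.
have saV' x : sa x -> sa (v t * x * v t).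
  by move=> sx; apply: sa_congr => //; apply: saV => //; exact/cone_sa/gc.
have cancel x : v t * (g t * x * g t) * v t = x.
  by rewrite /v !mulrA mulVr// mul1r mulrK.
have se : sa e by rewrite -(cancel e) -daE; apply: saV'; exact: cone_curve_sa ca It.
have sf : sa f by rewrite -(cancel f) -dbE; apply: saV'; exact: cone_curve_sa cb It.
have sw : sa w by rewrite -(cancel w) -dcE; apply: saV'; exact: cone_curve_sa cc It.
have := geometric_mean_speed dot_norm tau_state tau_tracial (sc t It) se sf sw.
rewrite dcE /c speed_congr// dbE -bE// speed_congr ?unitrMl//.
have -> : speed tau (a t) (da t) = hs tau e.
  rewrite daE (_ : a t = g t * 1 * g t) ?speed_congr ?unitr1//.
    by rewrite /speed /hs invr1 !mulr1.
  by rewrite mulr1 gE.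
exact.
Qed.

End MeanCurve.

(** * Lengths and distances *)

Section Distance.
Context (R : realType) (H : completeNormedModType R[i]).
Context (dot : {dot H for Num.conj}).
Hypothesis dot_norm : forall x : H, dot x x = `|x| ^+ 2.
Context (A : set (H -> H)).
Context (vnA : von_neumann_algebra dot A) (nz : (idfun : H -> H) <> 0).
Context (tau : (H -> H) -> R[i]).
Hypotheses (tau_state : is_state dot A tau) (tau_tracial : is_tracial A tau).
Local Notation B := (opalg vnA nz).
Local Notation I := (`[0, 1]%classic : set R).
Implicit Types (a b x y : B) (f df : R -> B) (J : set R) (s t m u : R).

Definition clength f df : R :=
  (\int[lebesgue_measure]_(t in `[0, 1]) speed tau (f t) (df t))%R.

Definition lengths a b : set R := [set l | exists f df,
  [/\ cone_curve f df, f 0 = a, f 1 = b & l = clength f df]].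

Lemma unit0 : I 0. Proof. by rewrite /= in_itv/= lexx ler01. Qed.
Lemma unit1 : I 1. Proof. by rewrite /= in_itv/= lexx ler01. Qed.

Lemma smooth_curve_cone_curve (g dg : R -> H -> H) : smooth_curve dot A g dg ->
  cone_curve (fun t => to_opalg vnA nz (g t)) (fun t => to_opalg vnA nz (dg t)) /\
  curve_length tau g dg =
  clength (fun t => to_opalg vnA nz (g t)) (fun t => to_opalg vnA nz (dg t)).
Proof.
move=> [gc gd dgc].
have Ag t : I t -> A (g t) by move=> /gc[].
have Adg t : I t -> A (dg t) by move=> /gd[].
split; first split=> t It.
- exact/to_opalg_cone/gc.
- exact: op_derivP (gd t It).
- by have := op_continuousP Adg dgc It; exact.
apply: eq_Rintegral => t; rewrite inE => It.
rewrite speed_metric; last exact/to_opalg_cone/gc.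
by rewrite !to_opalgK; [|exact: Adg|exact: Ag].
Qed.

Lemma cone_curve_smooth_curve f df : cone_curve f df ->
  smooth_curve dot A (fun t => opval (f t)) (fun t => opval (df t)) /\
  curve_length tau (fun t => opval (f t)) (fun t => opval (df t)) = clength f df.
Proof.
move=> [fc fd dfc]; split; first split=> //.
- by move=> t It; exact/deriv_op_deriv/fd.
- exact: continuous_op_continuous.
apply: eq_Rintegral => t; rewrite inE => It.
by rewrite speed_metric//; exact: fc.
Qed.

Lemma distE (S T : H -> H) : A S -> A T ->
  dist dot A tau S T = inf (lengths (to_opalg vnA nz S) (to_opalg vnA nz T)).
Proof.
move=> AS AT; congr inf; apply/seteqP; split=> l /=.
  move=> [g [dg [cg g0 g1 ->]]]; have [cc ->] := smooth_curve_cone_curve cg.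
  by do 2!eexists; split; [exact: cc|rewrite /= g0|rewrite /= g1|].
move=> [f [df [cf f0 f1 ->]]]; have [cc <-] := cone_curve_smooth_curve cf.
by do 2!eexists; split; [exact: cc|rewrite /= f0 to_opalgK|rewrite /= f1 to_opalgK|].
Qed.

Lemma speed_integrable f df : cone_curve f df ->
  lebesgue_measure.-integrable I (EFin \o (fun t => speed tau (f t) (df t))).
Proof.
move=> cf; have [_ _ dfc] := cf.
apply: continuous_compact_integrable; first exact: segment_compact.
apply/subspace_continuousP => t It.
apply: continuous_cvg; first exact: sqrt_continuous.
apply: (cvg_tr dot_norm tau_state).
have fV := cone_curve_inv_cont dot_norm cf It.
exact: cvg_opM (cvg_opM (cvg_opM (dfc t It) fV) (dfc t It)) fV.
Qed.

Lemma lengths_ge0 a b : lbound (lengths a b) 0.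
Proof.
move=> _ [f [df [_ _ _ ->]]]; apply: Rintegral_ge0 => t _.
exact: sqrtr_ge0.
Qed.

(** The speed of the line segment is controlled because [gap m] is a convex
   condition and bounds the norm of the inverse by [m^-1]. *)
Lemma lengths_segment m a b : 0 < m -> gap m a -> gap m b -> cone a -> cone b ->
  exists2 l, lengths a b l & l <= `|b - a| / m.
Proof.
move=> m0 ga gb ca cb.
pose f t := a + t *: (b - a); pose df (t : R) := b - a.
have gf t : I t -> gap m (f t).
  by rewrite /= in_itv/= => It; exact: gap_segment.
have cf : cone_curve f df.
  split=> t It.
  - apply: gap_cone (gf t It) _ => //; apply: adjD; first exact: cone_sa.
    by apply: adjZ; apply: adjB; exact: cone_sa.
  - exact: deriv_affine.
  - exact: cvg_cst.
exists (clength f df).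
  by exists f, df; split=> //; rewrite /f ?scale0r ?addr0// scale1r addrC subrK.
have K : forall t, I t -> speed tau (f t) (df t) <= `|b - a| / m.
  move=> t It; rewrite /speed /df; set z := b - a.
  have h : `|z * (f t)^-1| <= `|z| / m.
    rewrite (le_trans (opalg_normM _ _))// ler_wpM2l//.
    exact: inv_norm_le (gf t It).
  have K0 : 0 <= `|z| / m by rewrite divr_ge0// ltW.
  rewrite -(ger0_norm K0) -sqrtr_sqr; apply: ler_wsqrtr.
  rewrite -mulrA (le_trans (ler_norm _))// (le_trans (tr_le _ _ _))//.
  by rewrite (le_trans (opalg_normM _ _))// expr2 ler_pM.
have cst_int : lebesgue_measure.-integrable I (EFin \o (fun=> `|b - a| / m)).
  apply: continuous_compact_integrable; first exact: segment_compact.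
  by apply/subspace_continuousP => t It; exact: cvg_cst.
have : clength f df <= (\int[lebesgue_measure]_(t in `[0, 1]) (`|b - a| / m))%R.
  by apply: le_Rintegral => //; exact: speed_integrable.
rewrite Rintegral_cst//= lebesgue_measure_itv/= lte_fin ltr01 -EFinD/= subr0 mulr1.
exact.
Qed.

Lemma lengths_has_inf a b : cone a -> cone b -> has_inf (lengths a b).
Proof.
move=> ca cb; split; last by exists 0; exact: lengths_ge0.
have [m m0 ga] := cone_gap dot_norm ca; have [n n0 gb] := cone_gap dot_norm cb.
have [l hl _] : exists2 l, lengths a b l & l <= `|b - a| / Num.min m n.
  apply: lengths_segment => //; first by rewrite lt_min m0.
    by apply: gap_weaken ga; rewrite ge_min lexx.
  by apply: gap_weaken gb; rewrite ge_min lexx orbT.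
by exists l.
Qed.

Lemma dist_segment m a b : 0 < m -> gap m a -> gap m b -> cone a -> cone b ->
  inf (lengths a b) <= `|b - a| / m.
Proof.
move=> m0 ga gb ca cb; have [l hl] := lengths_segment m0 ga gb ca cb.
by apply: le_trans; apply: ge_inf => //; exists 0; exact: lengths_ge0.
Qed.

(** Conjugation by the square root of [a] reduces this to the uniqueness of
   positive square roots. *)
Lemma mean_unique a x y : cone a -> cone x -> cone y ->
  x * a^-1 * x = y * a^-1 * y -> x = y.
Proof.
move=> ca cx cy; have [s [cs <-]] := cone_sqrt dot_norm ca.
have us := cone_unit cs; have sV := saV us (cone_sa cs).
rewrite invrM// => E.
have cc z : cone z -> cone (s^-1 * z * s^-1).
  by move=> cz; apply: cone_congr; rewrite ?unitrV.
have : s^-1 * x * s^-1 = s^-1 * y * s^-1.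
  apply: (sqrt_unique dot_norm); [exact: cc|exact: cc|].
  have h z : s^-1 * z * s^-1 * (s^-1 * z * s^-1) =
      s^-1 * (z * (s^-1 * s^-1) * z) * s^-1.
    by nc_ring.
  by rewrite !h E.
move=> /(congr1 (fun z => s * z * s)).
by rewrite !mulrA divrr// !mul1r !mulrVK.
Qed.

(** Nearly minimal curves for the two pairs of endpoints have a geometric mean
   that joins [m0] to [m1], and its speed is at most the average of theirs. *)
Lemma dist_mean (a0 a1 b0 b1 m0 m1 : B) : cone a0 -> cone a1 -> cone b0 -> cone b1 ->
  cone m0 -> cone m1 -> m0 * a0^-1 * m0 = b0 -> m1 * a1^-1 * m1 = b1 ->
  inf (lengths m0 m1) <= 2^-1 * (inf (lengths a0 a1) + inf (lengths b0 b1)).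
Proof.
move=> ca0 ca1 cb0 cb1 cm0 cm1 e0 e1; apply/ler_addgt0Pr => e egt0.
have [_ [f [df [cf f0 f1 ->]]] lf] := inf_adherent egt0 (lengths_has_inf ca0 ca1).
have [_ [g [dg [cg g0 g1 ->]]] lg] := inf_adherent egt0 (lengths_has_inf cb0 cb1).
have [c [dc [cc cE cle]]] := cone_curve_mean dot_norm tau_state tau_tracial cf cg.
have [cc0 _ _] := cc.
have c0 : c 0 = m0.
  apply: (mean_unique ca0) => //; first exact: cc0 unit0.
  by rewrite e0 -f0 cE ?g0//; exact: unit0.
have c1 : c 1 = m1.
  apply: (mean_unique ca1) => //; first exact: cc0 unit1.
  by rewrite e1 -f1 cE ?g1//; exact: unit1.
have lc : clength c dc <= 2^-1 * (clength f df + clength g dg).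
  have fi := speed_integrable cf; have gi := speed_integrable cg.
  have fgi : lebesgue_measure.-integrable I
      (EFin \o (fun t => speed tau (f t) (df t) + speed tau (g t) (dg t))).
    rewrite (_ : _ \o _ = (fun t =>
      (speed tau (f t) (df t))%:E + (speed tau (g t) (dg t))%:E)%E)//.
    exact: integrableD.
  rewrite /clength -RintegralD// -RintegralZl//.
  apply: le_Rintegral => //; first exact: speed_integrable.
  rewrite (_ : _ \o _ = (fun t =>
    (2^-1)%:E * (speed tau (f t) (df t) + speed tau (g t) (dg t))%:E)%E)//.
  exact: integrableZl.
have : inf (lengths m0 m1) <= clength c dc.
  by apply: ge_inf; [exists 0; exact: lengths_ge0|exists c, dc].
lra.
Qed.

End Distance.

(** * Convexity *)

(** Let [S] be the supremum of the excess of [f] over the chord.  Every point of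
   a segment is the midpoint of an endpoint and another point of the segment,
   so the excess is at most [S / 2] everywhere, and [S <= S / 2]. *)
Lemma midpoint_convex (R : realType) (f : R -> R) (x y M : R) :
  let p u := u * x + (1 - u) * y in
  (forall u v, 0 <= u <= 1 -> 0 <= v <= 1 ->
     f (p ((u + v) / 2)) <= (f (p u) + f (p v)) / 2) ->
  (forall u, 0 <= u <= 1 -> f (p u) <= M) ->
  forall u, 0 <= u <= 1 -> f (p u) <= u * f x + (1 - u) * f y.
Proof.
move=> p fmid fM.
have p0 : p 0 = y by rewrite /p; ring.
have p1 : p 1 = x by rewrite /p; ring.
pose g u := f (p u) - (u * f x + (1 - u) * f y).
pose E := [set g u | u in [set u | 0 <= u <= 1]].
have g0 : g 0 = 0 by rewrite /g p0; ring.
have g1 : g 1 = 0 by rewrite /g p1; ring.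
have gmid u v : 0 <= u <= 1 -> 0 <= v <= 1 -> g ((u + v) / 2) <= (g u + g v) / 2.
  by move=> u01 v01; have := fmid u v u01 v01; rewrite /g; lra.
have Eub : has_ubound E.
  exists (M + `|f x| + `|f y|) => _ [u /= u01 <-]; have := fM u u01; rewrite /g.
  have := ler_norm (- f x); have := ler_norm (- f y); rewrite !normrN.
  case/andP: u01 => u0 u1 hy hx.
  have := ler_wpM2l u0 hx; have : 0 <= 1 - u by rewrite subr_ge0.
  move=> u1'; have := ler_wpM2l u1' hy.
  have := mulr_ge0 u1' (normr_ge0 (f x)); have := mulr_ge0 u0 (normr_ge0 (f y)); lra.
have gS u : 0 <= u <= 1 -> g u <= sup E by move=> u01; apply: ub_le_sup => //; exists u.
have half u : 0 <= u <= 1 -> g u <= sup E / 2.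
  move=> u01; have [u2|u2] := leP u (1 / 2).
  - have v01 : 0 <= 2 * u <= 1 by move/andP: u01 => [? ?]; apply/andP; split; lra.
    have := gmid 0 (2 * u); rewrite g0 (_ : (0 + 2 * u) / 2 = u); last by field.
    rewrite lexx ler01 => /(_ isT v01); have := gS _ v01; lra.
  - have v01 : 0 <= 2 * u - 1 <= 1 by move/andP: u01 => [? ?]; apply/andP; split; lra.
    have := gmid 1 (2 * u - 1).
    rewrite g1 (_ : (1 + (2 * u - 1)) / 2 = u); last by field.
    rewrite lexx ler01 => /(_ isT v01); have := gS _ v01; lra.
have S0 : sup E <= 0.
  have : sup E <= sup E / 2.
    apply: ge_sup; first by exists (g 0), 0 => //=; rewrite lexx ler01.
    by move=> _ [u /= u01 <-]; exact: half.
  lra.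
by move=> u u01; have := gS u u01; rewrite /g; lra.
Qed.

Section Convexity.
Context (R : realType) (H : completeNormedModType R[i]).
Context (dot : {dot H for Num.conj}).
Hypothesis dot_norm : forall x : H, dot x x = `|x| ^+ 2.
Context (A : set (H -> H)).
Context (vnA : von_neumann_algebra dot A) (nz : (idfun : H -> H) <> 0).
Context (tau : (H -> H) -> R[i]).
Hypotheses (tau_state : is_state dot A tau) (tau_tracial : is_tracial A tau).
Local Notation B := (opalg vnA nz).
Local Notation toB := (to_opalg vnA nz).

Lemma geodesic_cone J (g : R -> H -> H) t : geodesic_on dot A J g -> J t ->
  cone (toB (g t)).
Proof. by move=> [g1 [g2 geo]] /geo[cg _ _ _]; exact: to_opalg_cone. Qed.

Lemma geodesic_cont J (g : R -> H -> H) t : geodesic_on dot A J g -> J t ->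
  toB (g s) @[s --> within J (nbhs t)] --> toB (g t).
Proof.
move=> [g1 [g2 geo]] Jt; have [_ h _ _] := geo t Jt.
have Ag s : J s -> A (g s) by move=> /geo[[]].
have := deriv_cont (op_derivP (vnA := vnA) (nz := nz) Jt Ag h); exact.
Qed.

(** The norms of [g t] and of its inverse are bounded on a compact interval, and
   together they control the gap. *)
Lemma geodesic_bounds J (g : R -> H -> H) (a b : R) :
  geodesic_on dot A J g -> a <= b -> `[a, b]%classic `<=` J ->
  exists m K, 0 < m /\ forall t, `[a, b]%classic t ->
    gap m (toB (g t)) /\ `|toB (g t)| <= K.
Proof.
move=> geo ab abJ; pose G t := toB (g t).
have cG t : `[a, b]%classic t -> cone (G t) by move=> /abJ; exact: geodesic_cone.
have Gc t : `[a, b]%classic t -> G s @[s --> within `[a, b]%classic (nbhs t)] --> G t.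
  move=> /[dup] tab /abJ Jt; apply: cvg_trans (geodesic_cont geo Jt).
  by apply: cvg_app; exact: within_subset.
have bounded (F : R -> B) : (forall t, `[a, b]%classic t ->
    F s @[s --> within `[a, b]%classic (nbhs t)] --> F t) ->
  exists K, forall t, `[a, b]%classic t -> `|F t| <= K.
  move=> Fc; have cF : {within `[a, b], continuous (fun t => `|F t|)}.
    by apply/subspace_continuousP => t tab; apply: cvg_norm; exact: Fc.
  by have [c _ h] := EVT_max ab cF; exists `|F c|.
have [K hK] := bounded G Gc.
have [L hL] : exists L, forall t, `[a, b]%classic t -> `|(G t)^-1| <= L.
  apply: bounded => t tab; have [m m0 ga] := cone_gap dot_norm (cG t tab).
  apply: (cvg_opV m0 ga _ (Gc t tab)).
  by rewrite near_withinE; apply: nearW => s /cG/cone_unit.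
have aab : `[a, b]%classic a by rewrite /= in_itv/= lexx.
have cc t (tab : `[a, b]%classic t) := cone_gap_norm dot_norm (cG t tab).
have le_KL t : `[a, b]%classic t -> `|G t| * `|(G t)^-1| ^+ 2 <= K * L ^+ 2.
  move=> tab; have l0 := le_trans (normr_ge0 _) (hL t tab).
  by apply: ler_pM => //; [exact: hK|rewrite ler_sqr ?nnegrE//; exact: hL].
have KL0 : 0 < K * L ^+ 2 by apply: lt_le_trans (le_KL a aab); exact: (cc a aab).1.
exists (K * L ^+ 2)^-1, K; split=> [|t tab]; first by rewrite invr_gt0.
split; last exact: hK.
apply: gap_weaken (cc t tab).2; rewrite lef_pV2 ?posrE//; first exact: le_KL.
exact: (cc t tab).1.
Qed.

Lemma dist_midpoint J (g d : R -> H -> H) (s t : R) : is_interval J ->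
  geodesic_on dot A J g -> geodesic_on dot A J d -> J s -> J t ->
  dist dot A tau (g ((s + t) / 2)) (d ((s + t) / 2)) <=
    (dist dot A tau (g s) (d s) + dist dot A tau (g t) (d t)) / 2.
Proof.
move=> iJ geog geod; wlog st : s t / s < t.
  move=> W Js Jt; have [st|ts|->] := ltgtP s t; first exact: W.
    by rewrite [s + t]addrC [X in _ <= X / 2]addrC; exact: W.
  by rewrite (_ : (t + t) / 2 = t); [lra|field].
move=> Js Jt; have Jm : J ((s + t) / 2) by apply: iJ Js Jt _ _; apply/andP; split; lra.
have mem h u : geodesic_on dot A J h -> J u -> A (h u).
  by move=> [h1 [h2 geo]] /geo[[]].
rewrite [leRHS]mulrC !(distE vnA nz); do ?exact: mem.
have mg := geodesic_midpoint dot_norm vnA nz iJ geog Js Jt st.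
have md := geodesic_midpoint dot_norm vnA nz iJ geod Js Jt st.
apply: (dist_mean dot_norm tau_state tau_tracial _ _ _ _ _ _ mg md);
  by [exact: geodesic_cone geog _|exact: geodesic_cone geod _].
Qed.

Lemma dist_bounded J (g d : R -> H -> H) (a b : R) :
  geodesic_on dot A J g -> geodesic_on dot A J d ->
  a <= b -> `[a, b]%classic `<=` J ->
  exists M, forall t, `[a, b]%classic t -> dist dot A tau (g t) (d t) <= M.
Proof.
move=> geog geod ab abJ.
have [m [K [m0 hg]]] := geodesic_bounds geog ab abJ.
have [n [L [n0 hd]]] := geodesic_bounds geod ab abJ.
exists ((L + K) / Num.min m n) => t tab; have Jt := abJ _ tab.
have [gg gK] := hg t tab; have [gd dL] := hd t tab.
have mn0 : 0 < Num.min m n by rewrite lt_min m0.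
have mem h : geodesic_on dot A J h -> A (h t).
  by move=> [h1 [h2 geo]]; case: (geo t Jt) => -[].
rewrite (distE vnA nz); [|exact: mem..].
apply: (@le_trans _ _ (`|toB (d t) - toB (g t)| / Num.min m n)).
  apply: (dist_segment dot_norm tau_state mn0).
  - by apply: gap_weaken gg; rewrite ge_min lexx.
  - by apply: gap_weaken gd; rewrite ge_min lexx orbT.
  - exact: geodesic_cone geog Jt.
  - exact: geodesic_cone geod Jt.
rewrite ler_wpM2r ?invr_ge0 ?(ltW mn0)// (le_trans (ler_normB _ _))//.
exact: lerD.
Qed.

End Convexity.

Theorem corollary3p4 (R : realType)
  (H : completeNormedModType R[i]) (dot : {dot H for Num.conj})
  (dot_norm : forall x : H, dot x x = `|x| ^+ 2)
  (A : set (H -> H)) (tau : (H -> H) -> R[i])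
  (vnA : von_neumann_algebra dot A)
  (tau_state : is_state dot A tau) (tau_tracial : is_tracial A tau)
  (tau_normal : is_normal dot A tau) (tau_faithful : is_faithful dot A tau)
  (J : set R) (intJ : is_interval J)
  (gamma delta : R -> H -> H)
  (geo_gamma : geodesic_on dot A J gamma)
  (geo_delta : geodesic_on dot A J delta) :
  @convex_function R R^o J (fun t => dist dot A tau (gamma t) (delta t)).
Proof.
have nz : (idfun : H -> H) <> 0.
  move=> e; have [_ _ tau1] := tau_state; move: tau1; rewrite e.
  by rewrite (tau0 vnA tau_state) => /eqP; rewrite eq_sym oner_eq0.
move=> t x y; rewrite !inE => Jx Jy.
pose f s := dist dot A tau (gamma s) (delta s).
have t01 : 0 <= t%:num <= 1 by apply/andP; split.
have sub : `[Num.min x y, Num.max x y]%classic `<=` J.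
  move=> s; rewrite /= in_itv/= => sxy.
  by have [xy|xy] := leP x y; move: sxy; rewrite ?(min_l xy) ?(max_r xy);
    [exact: intJ Jx Jy _|
     rewrite (min_r (ltW xy)) (max_l (ltW xy)); exact: intJ Jy Jx _].
have mem u : 0 <= u <= 1 -> `[Num.min x y, Num.max x y]%classic (u * x + (1 - u) * y).
  move=> /andP[u0 u1]; have u1' : 0 <= 1 - u by rewrite subr_ge0.
  rewrite /= in_itv/=; have [xy|xy] := leP x y.
    have := ler_wpM2l u0 xy; have := ler_wpM2l u1' xy => h1 h2.
    by apply/andP; split; lra.
  have := ler_wpM2l u0 (ltW xy); have := ler_wpM2l u1' (ltW xy) => h1 h2.
  by apply/andP; split; lra.
have ge_min_max : Num.min x y <= Num.max x y by rewrite le_max ge_min lexx.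
have [M hM] := dist_bounded dot_norm vnA nz tau_state geo_gamma geo_delta
  ge_min_max sub.
have := @midpoint_convex R f x y M _ _ _ t01; apply.
  move=> u v u01 v01.
  have -> : (u + v) / 2 * x + (1 - (u + v) / 2) * y =
     ((u * x + (1 - u) * y) + (v * x + (1 - v) * y)) / 2 by field.
  apply: (dist_midpoint dot_norm vnA nz tau_state tau_tracial intJ) => //;
    exact/sub/mem.
by move=> u u01; exact/hM/mem.
Qed.
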